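(* Let $(X,d,\mu)$, $p$, $\underline{Q}_\mu$ be as in the context. Fix $\underline{\theta}\in[0,\min\{p,\underline{Q}_\mu\})$, $\theta\in[\underline{\theta},p)$, an integer $N\ge2$, numbers $0<\theta_1<\dots<\theta_N=\underline{\theta}$, closed sets $S^i\in\mathcal{ADR}_{\theta_i}(X)$, $S:=\bigcup_{i=1}^NS^i$, and $\mathfrak m_k:=\sum_{i=1}^N2^{k(\theta-\theta_i)}\mathcal H_{\theta_i}\lfloor_{S^i}$, $k\in\mathbb N_0$. For each $i$ let $\sigma_i\in(0,1)$ be such that $S^i$ is $\sigma_i$-porous, and put $\sigma(S):=\prod_{i=1}^N\frac{2\sigma_i}{3}$. Then for each $\sigma\in(0,\sigma(S)]$ there is a constant $C>0$ such that $$\operatorname{BN}_{p,\{\mathfrak m_k\},\sigma}(f)\le C\Big(\sum_{i=1}^N\|f|\mathrm B^{1-\theta_i/p}_p(S^i)\|+\mathcal{GL}^{(1)}_p(f)\Big)\quad\text{for all } f\in\bigcap_{i=1}^NL_p(\mathcal H_{\theta_i}\lfloor_{S^i}).$$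
   Context: Standing setting: $(X,d)$ complete separable metric space, $\mu$ a Borel regular locally finite outer measure, $\operatorname{supp}\mu=X$, uniformly locally doubling (for every $R>0$, $\sup_{r\in(0,R]}\sup_x\mu(B_{2r}(x))/\mu(B_r(x))<\infty$). Balls are closed, $B_r(x)=\{y:d(x,y)\le r\}$, $cB_r(x)=B_{cr}(x)$, $B_k(x)=B_{2^{-k}}(x)$. A fixed $p\in(1,\infty)$; $X$ supports a weak local $(1,p)$-Poincaré inequality (for every $R>0$ there are $C,\lambda\ge1$ with $\inf_c\frac{1}{\mu(B_r(x))}\int_{B_r(x)}|f-c|d\mu\le Cr(\frac{1}{\mu(B_{\lambda r}(x))}\int_{B_{\lambda r}(x)}(\operatorname{lip}f)^pd\mu)^{1/p}$ for Lipschitz $f$, $x\in X$, $r\in(0,R]$, with $\operatorname{lip}f(y)=\limsup_{z\to y}|f(y)-f(z)|/d(y,z)$). $\underline{Q}_\mu$ is the infimum of $Q>0$ such that for every $R>0$ there is $C$ with $(r_{B'}/r_B)^Q\le C\mu(B')/\mu(B)$ for balls $B'\subset B$, $0<r_{B'}\le r_B\le R$. Notation: $\mathrm{Av}_{G,\mathfrak m}(g)=\mathfrak m(G)^{-1}\int_Gg\,d\mathfrak m$ if $\mathfrak m(G)>0$, else $0$; $\mathcal E_{\mathfrak m}(g,G):=\inf_{c\in\mathbb R}\mathrm{Av}_{G,\mathfrak m}(|g-c|)$; $\mathfrak m\lfloor_S(E)=\mathfrak m(E\cap S)$. $\mathcal H_{\vartheta,\delta}(E):=\inf\{\sum\mu(B_{r_i}(x_i))r_i^{-\vartheta}:E\subset\bigcup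 B_{r_i}(x_i),0<r_i<\delta\}$, $\mathcal H_\vartheta=\lim_{\delta\to0}\mathcal H_{\vartheta,\delta}$. $\mathcal{ADR}_\vartheta(X)$: closed $S'$ with $\varkappa_1\mu(B_r(x))r^{-\vartheta}\le\mathcal H_\vartheta(B_r(x)\cap S')\le\varkappa_2\mu(B_r(x))r^{-\vartheta}$ for $x\in S'$, $r\in(0,1]$. Porosity: a ball $B$ is $(S',\sigma)$-porous if there is a ball $B'\subset B\setminus S'$ with $r(B')\ge\sigma r(B)$; $S'_r(\sigma):=\{x\in S':B_r(x)\text{ is }(S',\sigma)\text{-porous}\}$; $S'$ is $\sigma$-porous if $S'_r(\sigma)=S'$ for all $r\in(0,1]$. Besov norm: for $S'\in\mathcal{ADR}_\vartheta(X)$, $s>0$: $\|f|\mathrm B^s_p(S')\|:=\|f|L_p(\mathcal H_\vartheta\lfloor_{S'})\|+(\sum_{k\ge1}2^{ksp}\int_{S'}(\mathcal E_{\mathcal H_\vartheta\lfloor_{S'}}(f,B_k(x)))^pd\mathcal H_\vartheta(x))^{1/p}$. Functional $\operatorname{BN}$: for $r>0$ let $k(r)$ be the integer with $r\in(2^{-k(r)-1},2^{-k(r)}]$; $\widetilde{\mathcal E}_{\mathfrak m_k}(f,B_r(x)):=\mathcal E_{\mathfrak m_k}(f,B_{2r}(x))$ if $B_r(x)\cap S\ne\emptyset$ and $0$ otherwise; $f^\sharp(x):=\sup_{r\in(0,1]}\frac1r\widetilde{\mathcal E}_{\mathfrak m_{k(r)}}(f,B_r(x))$, $x\in X$. Then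 $\operatorname{BN}_{p,\{\mathfrak m_k\},\sigma}(f):=\|f|L_p(\mathfrak m_0)\|+\|f^\sharp|L_p(S,\mu)\|+\big(\sum_{k\ge1}2^{k(\theta-p)}\int_{S_{2^{-k}}(\sigma)}(\mathcal E_{\mathfrak m_k}(f,B_k(x)))^pd\mathfrak m_k(x)\big)^{1/p}$. Gluing functional: $\Sigma^{i,j}_k:=\{(y,z)\in S^i\times S^j:d(y,z)\le2^{-k}\}$, $\operatorname{w}_k(y,z):=(\mu(B_k(y))\mu(B_k(z)))^{-1/2}$, $\mathcal{GL}^{(1)}_p(f):=\big(\sum_{i\ne j}\sum_{k\ge1}2^{k(p-\theta_i-\theta_j)}\iint_{\Sigma^{i,j}_k}\operatorname{w}_k(y,z)|f(y)-f(z)|^pd\mathcal H_{\theta_i}(y)d\mathcal H_{\theta_j}(z)\big)^{1/p}$. *)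

(* Defs.v *)
From HB Require Import structures.
From mathcomp Require Import all_boot all_order all_algebra.
From mathcomp Require Import all_classical all_reals all_analysis.
Import Order.TTheory GRing.Theory Num.Theory.
Set Implicit Arguments. Unset Strict Implicit. Unset Printing Implicit Defensive.
Local Open Scope classical_set_scope.
Local Open Scope ring_scope.

Section MetricMeasure.
Context {R : realType} {d0 : measure_display} {X : measurableType d0}.
Variable dist : X -> X -> R.

Definition cball (x : X) (r : R) : set X := [set y | dist x y <= r].

Definition is_metric : Prop :=
  [/\ forall x y, 0 <= dist x y,
      forall x y, dist x y = 0 <-> x = y,
      forall x y, dist x y = dist y x &
      forall x y z, dist x z <= dist x y + dist y z].

Definition dcomplete : Prop :=
  forall u : nat -> X,
    (forall e, 0 < e -> exists M, forall m n, (M <= m)%N -> (M <= n)%N ->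
        dist (u m) (u n) < e) ->
    exists l, forall e, 0 < e -> exists M, forall n, (M <= n)%N -> dist (u n) l < e.

Definition dseparable : Prop :=
  exists D : set X, countable D /\
    forall x e, 0 < e -> exists2 y, D y & dist x y < e.

Definition dopen (A : set X) : Prop :=
  forall x, A x -> exists2 r, 0 < r & [set y | dist x y < r] `<=` A.

Definition dclosed (A : set X) : Prop :=
  forall x, (forall e, 0 < e -> exists2 y, A y & dist x y < e) -> A x.

Definition borel_sets : Prop := (@measurable d0 X) = <<s dopen >>.

Definition lipschitz (f : X -> R) : Prop :=
  exists L : R, forall x y, `|f x - f y| <= L * dist x y.

(* lip f(y) = limsup_{z -> y} |f(y)-f(z)|/d(y,z)  (0 at isolated points) *)
Definition lipf (f : X -> R) (y : X) : \bar R :=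
  ereal_inf [set ereal_sup ([set 0%E] `|`
       [set (`|f y - f z| / dist y z)%:E | z in [set z | 0 < dist y z < del]])
    | del in [set del : R | 0 < del]].

(* Av_{G,m}(g) for a "measure" given by its mass m and integration functional I *)
Definition AvE (m : set X -> \bar R) (I : set X -> (X -> \bar R) -> \bar R)
  (G : set X) (g : X -> \bar R) : \bar R :=
  if (0 < m G)%E then (((fine (m G))^-1)%:E * I G g)%E else 0%E.

Definition oscE (m : set X -> \bar R) (I : set X -> (X -> \bar R) -> \bar R)
  (f : X -> R) (G : set X) : \bar R :=
  ereal_inf [set AvE m I G (fun x => (`|f x - c|)%:E) | c in [set: R]].

Variable mu : {measure set X -> \bar R}.

Definition mu_int (G : set X) (g : X -> \bar R) : \bar R := (\int[mu]_(x in G) g x)%E.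

Definition locally_finite : Prop :=
  forall x, exists2 r, 0 < r & (mu (cball x r) < +oo)%E.

Definition full_support : Prop :=
  forall x r, 0 < r -> (0 < mu (cball x r))%E.

Definition unif_loc_doubling : Prop :=
  forall R0, 0 < R0 -> exists C : R, forall x r, 0 < r <= R0 ->
    (mu (cball x (2 * r)) <= C%:E * mu (cball x r))%E.

Definition poincare (p : R) : Prop :=
  forall R0, 0 < R0 -> exists C lam : R, 1 <= C /\ 1 <= lam /\
    forall f, lipschitz f -> forall x r, 0 < r <= R0 ->
      (oscE mu mu_int f (cball x r) <=
        (C * r)%:E * ((AvE mu mu_int (cball x (lam * r))
                         (fun y => lipf f y `^ p)) `^ p^-1))%E.

Definition Q_admissible (Q : R) : Prop :=
  0 < Q /\ forall R0, 0 < R0 -> exists C : R,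
    forall x x' r r', 0 < r' -> r' <= r -> r <= R0 ->
      cball x' r' `<=` cball x r ->
      (((r' / r) `^ Q)%:E * mu (cball x r) <= C%:E * mu (cball x' r'))%E.

Definition Q_lower : \bar R := ereal_inf [set Q%:E | Q in Q_admissible].

(* H_{vartheta,delta}: covers indexed by an arbitrary I \subset nat
   (finite or countable) *)
Definition Hcont_delta (th del : R) (E : set X) : \bar R :=
  ereal_inf [set s | exists (I : set nat) (x : nat -> X) (r : nat -> R),
      E `<=` \bigcup_(i in I) cball (x i) (r i) /\
      (forall i, I i -> 0 < r i < del) /\
      s = (\esum_(i in I) (mu (cball (x i) (r i)) * ((r i) `^ (- th))%:E))%E].

(* H_vartheta = lim_{delta -> 0} H_{vartheta,delta} (monotone, hence a sup) *)
Definition Hcont (th : R) (E : set X) : \bar R :=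
  ereal_sup [set Hcont_delta th del E | del in [set del : R | 0 < del]].

Definition ADR (th : R) (S : set X) : Prop :=
  dclosed S /\ exists k1 k2 : R, 0 < k1 /\ 0 < k2 /\
    forall x r, S x -> 0 < r <= 1 ->
      ((k1 * r `^ (- th))%:E * mu (cball x r) <= Hcont th (cball x r `&` S))%E /\
      (Hcont th (cball x r `&` S) <= (k2 * r `^ (- th))%:E * mu (cball x r))%E.

Definition porous_ball (S : set X) (sig : R) (x : X) (r : R) : Prop :=
  exists (y : X) (r' : R), sig * r <= r' /\ cball y r' `<=` cball x r `\` S.

Definition porous_part (S : set X) (sig r : R) : set X :=
  [set x | S x /\ porous_ball S sig x r].

Definition porous (S : set X) (sig : R) : Prop :=
  forall r, 0 < r <= 1 -> porous_part S sig r = S.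

Section Family.
Variables (N : nat) (p theta : R) (th : 'I_N -> R) (S : 'I_N -> set X)
  (H : 'I_N -> {measure set X -> \bar R}).

Definition Sall : set X := \bigcup_(i in [set: 'I_N]) S i.

Definition coef (k : nat) (i : 'I_N) : R := 2 `^ (k%:R * (theta - th i)).

Definition mk_mass (k : nat) (G : set X) : \bar R :=
  (\sum_(i < N) (coef k i)%:E * H i (G `&` S i))%E.

Definition mk_int (k : nat) (G : set X) (g : X -> \bar R) : \bar R :=
  (\sum_(i < N) (coef k i)%:E * \int[H i]_(x in G `&` S i) g x)%E.

Definition Etilde (f : X -> R) (k : nat) (r : R) (x : X) : \bar R :=
  if `[< cball x r `&` Sall !=set0 >] then oscE (mk_mass k) (mk_int k) f (cball x (2 * r))
  else 0%E.

(* f^sharp(x) = sup_{r in (0,1]} r^{-1} \tilde E_{m_{k(r)}}(f,B_r(x)),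
   where k(r) is the integer with r in (2^{-k-1}, 2^{-k}] *)
Definition fsharp (f : X -> R) (x : X) : \bar R :=
  ereal_sup [set v | exists (k : nat) (r : R),
     [/\ 2 ^- k.+1 < r, r <= 2 ^- k, 0 < r <= 1 &
         v = ((r^-1)%:E * Etilde f k r x)%E]].

Definition BN (sigma : R) (f : X -> R) : \bar R :=
  (mk_int 0 [set: X] (fun x => (`|f x| `^ p)%:E) `^ p^-1
   + (\int[mu]_(x in Sall) (fsharp f x `^ p)) `^ p^-1
   + (\sum_(1 <= k <oo)
        (2 `^ (k%:R * (theta - p)))%:E *
        mk_int k (porous_part Sall sigma (2 ^- k))
          (fun x => oscE (mk_mass k) (mk_int k) f (cball x (2 ^- k)) `^ p)) `^ p^-1)%E.

Definition Besov (i : 'I_N) (s : R) (f : X -> R) : \bar R :=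
  ((\int[H i]_(x in S i) (`|f x| `^ p)%:E) `^ p^-1
   + (\sum_(1 <= k <oo)
        (2 `^ (k%:R * s * p))%:E *
        \int[H i]_(x in S i)
          (oscE (fun G => H i (G `&` S i))
                (fun G g => \int[H i]_(y in G `&` S i) g y)
                f (cball x (2 ^- k)) `^ p)) `^ p^-1)%E.

Definition wk (k : nat) (y z : X) : R :=
  (fine (mu (cball y (2 ^- k))) * fine (mu (cball z (2 ^- k)))) `^ (- 2^-1).

Definition GL1 (f : X -> R) : \bar R :=
  (\sum_(i < N) \sum_(j < N | i != j) \sum_(1 <= k <oo)
     (2 `^ (k%:R * (p - th i - th j)))%:E *
     \int[H i]_(y in S i) \int[H j]_(z in S j)
        (if (dist y z <= 2 ^- k)%R then (wk k y z * `|f y - f z| `^ p)%:E else 0))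
  `^ p^-1.

Definition in_Lp_all (f : X -> R) : Prop :=
  forall i, measurable_fun (S i) f /\
    (\int[H i]_(x in S i) (`|f x| `^ p)%:E < +oo)%E.

End Family.
End MetricMeasure.

(* Main.v *)
(** Since [th i > 0], the set [S] is [mu]-null, so the [f^sharp] term of [BN]
    vanishes; its first term is a sum of [L_p] norms.  In the third term the
    porous part is enlarged to [S].  Let [B = B_k(x)] with [x] in [S i].
    Averaging [|f z - c| <= |f y - f z| + |f y - c|] over [y] in [B `&` S i] and
    [z] in [B `&` S j] shows that [E_{m_k}(f,B)] exceeds [E_{H i}(f,B)] by at
    most a weighted mean of [|f y - f z|], taken over [j != i]; Jensen's
    inequality passes to [p]-th powers.  Integrating in [x] and exchanging the
    integrals by Tonelli turns this mean into the gluing energy at scale [k - 1],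
    as two points of [B_k(x)] are [2^(1-k)]-close.  At [k = 1] that energy is not
    part of [GL1]; there [c = 0] and the [L_p] norms suffice. *)

Require Import Defs.
From HB Require Import structures.
From mathcomp Require Import all_boot all_order all_algebra.
From mathcomp Require Import all_classical all_reals all_analysis.
From mathcomp Require Import measurable_realfun.
From mathcomp Require Import ring lra.
Import Order.TTheory GRing.Theory Num.Theory.
Import numFieldNormedType.Exports.
Set Implicit Arguments. Unset Strict Implicit. Unset Printing Implicit Defensive.
Local Open Scope classical_set_scope.
Local Open Scope ring_scope.

(** * Powers of extended reals *)

Section PowersOfExtendedReals.
Context {R : realType}.
Implicit Types (p c s t : R) (x y : \bar R).
Local Open Scope ereal_scope.

Lemma lee_poweR p x y : (0 <= p)%R -> 0 <= x -> x <= y -> x `^ p <= y `^ p.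
Proof.
move=> p0 x0 xy; apply: gt0_ler_poweR => //; rewrite in_itv/= leey andbT//.
exact: le_trans xy.
Qed.

Lemma poweRK p x : p != 0%R -> 0 <= x -> (x `^ p) `^ p^-1 = x.
Proof. by move=> p0 x0; rewrite -poweRrM divff// poweRe1. Qed.

Lemma poweRVK p x : p != 0%R -> 0 <= x -> (x `^ p^-1) `^ p = x.
Proof. by move=> p0 x0; rewrite -poweRrM mulVf// poweRe1. Qed.

Lemma le_poweRV p x y : (0 < p)%R -> 0 <= x -> x `^ p^-1 <= y -> x <= y `^ p.
Proof.
move=> p0 x0 xy; rewrite -(@poweRVK p x) ?gt_eqF//.
by apply: lee_poweR; [exact: ltW|exact: poweR_ge0|].
Qed.

Lemma poweRV_le p c x y : (0 < p)%R -> (0 <= c)%R -> 0 <= x -> 0 <= y ->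
  x <= c%:E * y `^ p -> x `^ p^-1 <= (c `^ p^-1)%:E * y.
Proof.
move=> p0 c0 x0 y0 xy; rewrite -poweR_EFin -[in leRHS](@poweRK p y) ?gt_eqF//.
rewrite -poweRM ?poweR_ge0//; apply: lee_poweR => //.
by rewrite invr_ge0 ltW.
Qed.

Lemma poweR_sum_le p (I : finType) (x : I -> \bar R) :
  (0 < p)%R -> (forall j, 0 <= x j) ->
  (\sum_j x j) `^ p <= (#|I|%:R `^ p)%:E * \sum_j x j `^ p.
Proof.
move=> p0 x0; set S := \sum_j x j `^ p.
have S0 : 0 <= S by apply: sume_ge0 => j _; exact: poweR_ge0.
have xS j : x j <= S `^ p^-1.
  rewrite -(@poweRK p (x j)) ?gt_eqF//; apply: lee_poweR; first by rewrite invr_ge0 ltW.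
    exact: poweR_ge0.
  by rewrite /S (bigD1 j)//= leeDl// sume_ge0// => *; exact: poweR_ge0.
have sumS : \sum_j x j <= #|I|%:R%:E * S `^ p^-1.
  apply: (@le_trans _ _ (\sum_(j in I) S `^ p^-1)); first exact: lee_sum.
  by rewrite sumr_const mule_natl.
apply: le_trans (lee_poweR (ltW p0) _ sumS) _; first exact: sume_ge0.
by rewrite poweRM ?lee_fin ?poweR_ge0// poweR_EFin poweRVK// gt_eqF.
Qed.

Lemma poweR_contraction_le p c x : (1 <= p)%R -> (0 <= c <= 1)%R -> 0 <= x ->
  (c%:E * x) `^ p <= c%:E * x `^ p.
Proof.
move=> p1 /andP[c0 c1] x0; rewrite poweRM ?lee_fin// poweR_EFin.
apply: lee_wpmul2r; first exact: poweR_ge0.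
rewrite lee_fin -[leRHS]powRr1//.
have [->|c_neq0] := eqVneq c 0%R; first by rewrite !powR0// gt_eqF// (lt_le_trans ltr01).
by apply: ger_powR => //; rewrite lt0r c_neq0 c0.
Qed.

Lemma poweR_combination_le p (I : finType) (c : I -> R) (x : I -> \bar R) :
  (1 <= p)%R -> (forall j, 0 <= c j <= 1)%R -> (forall j, 0 <= x j) ->
  (\sum_j (c j)%:E * x j) `^ p <= (#|I|%:R `^ p)%:E * \sum_j (c j)%:E * x j `^ p.
Proof.
move=> p1 c01 x0; have p0 : (0 < p)%R by rewrite (lt_le_trans ltr01).
apply: (le_trans (poweR_sum_le p0 _)).
  by move=> j; rewrite mule_ge0// lee_fin; case/andP : (c01 j).
apply: lee_wpmul2l; first by rewrite lee_fin powR_ge0.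
by apply: lee_sum => j _; exact: poweR_contraction_le.
Qed.

Lemma le_poweR_tangent p s x : (1 < p)%R -> (0 < s)%R -> 0 <= x ->
  x <= ((1 - p^-1) * s)%:E + (p^-1 * s `^ (1 - p))%:E * x `^ p.
Proof.
move=> p1 s0; have p0 : (0 < p)%R by rewrite (lt_trans ltr01).
have sp0 : (0 < s `^ (1 - p))%R by rewrite powR_gt0.
case: x => [t|_|//]; last first.
  by rewrite poweRyr ?gt_eqF// gt0_muley ?addey ?leey// lte_fin mulr_gt0// invr_gt0.
rewrite !lee_fin => t0.
have sN : (s `^ (1 - p) * s `^ (p - 1) = 1)%R.
  by rewrite -powRD ?(gt_eqF s0) ?implybT// addrC subrKA subrr powRr0.
have sp : (s `^ (1 - p) * s `^ p = s)%R.
  by rewrite -powRD ?(gt_eqF s0) ?implybT// subrK powRr1// ltW.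
have q0 : (0 < 1 - p^-1)%R by rewrite subr_gt0 invf_lt1.
have young : (t * s `^ (p - 1) <= t `^ p / p + s `^ p * (1 - p^-1))%R.
  have -> : (s `^ p = (s `^ (p - 1)) `^ (1 - p^-1)^-1)%R.
    by rewrite -powRrM; congr powR; field; rewrite subr_eq0 !gt_eqF.
  rewrite -[X in (_ + _ * X)%R]invrK; apply: conjugate_powR => //.
  - exact: powR_ge0.
  - by rewrite invr_gt0.
  - by rewrite invrK subrKC.
rewrite -(ler_pM2l sp0) mulrCA sN mulr1 in young; apply: (le_trans young).
have -> : (s `^ (1 - p) * (t `^ p / p + s `^ p * (1 - p^-1)) =
  (1 - p^-1) * (s `^ (1 - p) * s `^ p) + p^-1 * s `^ (1 - p) * t `^ p)%R by ring.
by rewrite sp.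
Qed.

End PowersOfExtendedReals.

(** * Integration *)

Section Integration.
Context d (T : measurableType d) (R : realType).
Variable mu : {measure set T -> \bar R}.
Implicit Types (f g : T -> \bar R) (A B D S : set T).
Local Open Scope ereal_scope.
Import HBNNSimple.

(* No measurability: the integral of a nonnegative function is a supremum over
   the simple functions below it. *)
Lemma ge0_le_integral_subset A B f g :
  (forall x, A x -> 0 <= f x) -> (forall x, B x -> 0 <= g x) ->
  A `<=` B -> (forall x, A x -> f x <= g x) ->
  \int[mu]_(x in A) f x <= \int[mu]_(x in B) g x.
Proof.
move=> f0 g0 AB fg; rewrite !ge0_integralE//; apply: ereal_sup_le => _ [h /= hf <-].
exists h => // x; apply: (le_trans (hf x)); rewrite /patch.
case: ifPn => [/set_mem Ax|_]; first by rewrite mem_set; [exact: fg|exact: AB].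
by case: ifPn => [/set_mem /g0|].
Qed.

Lemma integral_null_set D f : measurable D -> mu D = 0 ->
  \int[mu]_(x in D) f x = 0.
Proof.
move=> mD D0; rewrite (eq_measure_integral mzero); first exact: integral_measure_zero.
by move=> A mA AD; exact: (subset_measure0 mA mD AD D0).
Qed.

Lemma integral_mrestr_subset D S (mS : measurable S) f : D `<=` S ->
  \int[mrestr mu mS]_(x in D) f x = \int[mu]_(x in D) f x.
Proof.
move=> DS; apply: eq_measure_integral => A _ AD; rewrite /= /mrestr setIidl//.
exact: subset_trans DS.
Qed.

Lemma ge0_integral_mrestr D S (mS : measurable S) f : measurable D ->
  measurable_fun D f -> (forall x, D x -> 0 <= f x) ->
  \int[mrestr mu mS]_(x in D) f x = \int[mu]_(x in D `&` S) f x.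
Proof.
move=> mD mf f0; rewrite (@ge0_negligible_integral _ _ _ (mrestr mu mS) D (~` S))//.
- by rewrite setDE setCK integral_mrestr_subset//; exact: subIsetr.
- exact: measurableC.
- by rewrite /= /mrestr setICl measure0.
Qed.

End Integration.

Section SectionIntegrals.
Context d1 d2 (T1 : measurableType d1) (T2 : measurableType d2) (R : realType).
Variable A : set (T1 * T2).
Hypothesis mA : measurable A.
Variable f : T1 * T2 -> \bar R.
Hypotheses (f0 : forall z, (0 <= f z)%E) (mf : measurable_fun setT f).
Local Open Scope ereal_scope.

Let fA_ge0 z : 0 <= (f \_ A) z. Proof. exact: erestrict_ge0. Qed.

Let measurable_fA : measurable_fun setT (f \_ A).
Proof. by apply/(measurable_restrictT _ mA); exact: measurable_funTS. Qed.

Let integral_xsectionE (m2 : {measure set T2 -> \bar R}) x :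
  \int[m2]_(y in xsection A x) f (x, y) = \int[m2]_y (f \_ A) (x, y).
Proof.
rewrite integral_mkcond; apply: eq_integral => y _.
by rewrite !patchE mem_xsection.
Qed.

Let integral_ysectionE (m1 : {measure set T1 -> \bar R}) y :
  \int[m1]_(x in ysection A y) f (x, y) = \int[m1]_x (f \_ A) (x, y).
Proof.
rewrite integral_mkcond; apply: eq_integral => x _.
by rewrite !patchE mem_ysection.
Qed.

Lemma measurable_integral_xsection (m2 : {sigma_finite_measure set T2 -> \bar R}) :
  measurable_fun setT (fun x => \int[m2]_(y in xsection A x) f (x, y)).
Proof.
under eq_fun do rewrite integral_xsectionE.
exact: measurable_fun_fubini_tonelli_F.
Qed.

Lemma fubini_tonelli_section (m1 : {sigma_finite_measure set T1 -> \bar R})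
    (m2 : {sigma_finite_measure set T2 -> \bar R}) :
  \int[m1]_x \int[m2]_(y in xsection A x) f (x, y) =
  \int[m2]_y \int[m1]_(x in ysection A y) f (x, y).
Proof.
under eq_integral do rewrite integral_xsectionE.
rewrite (fubini_tonelli _ measurable_fA fA_ge0).
by under [RHS]eq_integral do rewrite integral_ysectionE.
Qed.

End SectionIntegrals.

(** * Averages and oscillations *)

Section Averages.
Context {R : realType} {d : measure_display} {X : measurableType d}.
Local Open Scope ereal_scope.

(* The test [0 < m G] in the definition is redundant since [0^-1 = 0]. *)
Lemma AvEE (m : set X -> \bar R) I G g :
  0 <= m G -> AvE m I G g = ((fine (m G))^-1)%:E * I G g.
Proof.
move=> m0; rewrite /AvE; case: ifPn => //; rewrite -leNgt => mG0.
by rewrite (@le_anti _ _ (m G) 0) ?mG0// invr0 mul0e.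
Qed.

Lemma eq_oscE (m m' : set X -> \bar R) I I' (f f' : X -> R) G :
  m G = m' G ->
  (forall c, I G (fun x => (`|f x - c|)%:E) = I' G (fun x => (`|f' x - c|)%:E)) ->
  oscE m I f G = oscE m' I' f' G.
Proof.
move=> mm' II'; congr ereal_inf; apply: eq_imagel => c _.
by rewrite /AvE mm' II'.
Qed.

Lemma oscE_ge0 (m : set X -> \bar R) I (f : X -> R) G :
  0 <= m G -> (forall g, (forall x, 0 <= g x) -> 0 <= I G g) -> 0 <= oscE m I f G.
Proof.
move=> m0 I0; apply: le_ereal_inf_tmp => _ [c _ <-]; rewrite AvEE//.
by rewrite mule_ge0 ?lee_fin ?invr_ge0 ?fine_ge0// I0.
Qed.

End Averages.

Section MeasureAverages.
Context {R : realType} {d : measure_display} {X : measurableType d}.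
Variables (nu : {measure set X -> \bar R}) (B : set X).
Hypothesis mB : measurable B.
Implicit Types (f g : X -> \bar R) (F : X -> R) (c p s : R) (z : \bar R).
Local Open Scope ereal_scope.
Local Notation avg := (AvE nu (mu_int nu) B).

Let avgE g : avg g = ((fine (nu B))^-1)%:E * \int[nu]_(x in B) g x.
Proof. by rewrite AvEE. Qed.

Lemma AvE_ge0 g : (forall x, B x -> 0 <= g x) -> 0 <= avg g.
Proof. by move=> g0; rewrite avgE mule_ge0// integral_ge0. Qed.

Lemma AvE_le f g : (forall x, B x -> 0 <= f x) -> (forall x, B x -> f x <= g x) ->
  avg f <= avg g.
Proof.
move=> f0 fg; rewrite !avgE; apply: lee_wpmul2l => //.
by apply: ge0_le_integral_subset => // x Bx; apply: le_trans (fg _ Bx); exact: f0.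
Qed.

Lemma AvED f g : (forall x, B x -> 0 <= f x) -> measurable_fun B f ->
  (forall x, B x -> 0 <= g x) -> measurable_fun B g ->
  avg (fun x => f x + g x) = avg f + avg g.
Proof.
by move=> f0 mf g0 mg; rewrite !avgE ge0_integralD// ge0_muleDr// integral_ge0.
Qed.

Lemma AvEZl c g : (0 <= c)%R -> (forall x, B x -> 0 <= g x) -> measurable_fun B g ->
  avg (fun x => c%:E * g x) = c%:E * avg g.
Proof. by move=> c0 g0 mg; rewrite !avgE ge0_integralZl// muleCA. Qed.

Lemma AvE_cst z : 0 < nu B < +oo -> avg (cst z) = z.
Proof.
move=> /andP[nu_gt0 nu_lty]; rewrite avgE integral_cst// muleCA.
have nuE : nu B = (fine (nu B))%:E by rewrite fineK// ge0_fin_numE.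
rewrite [X in _ * (_ * X)]nuE -EFinM mulVf ?mule1// gt_eqF// fine_gt0//.
by rewrite nu_gt0.
Qed.

Lemma AvE_cst_le z : 0 <= z -> avg (cst z) <= z.
Proof.
move=> z0; have [nuB|] := boolP (0 < nu B < +oo); first by rewrite AvE_cst.
rewrite negb_and -!leNgt leye_eq => nuB; rewrite avgE (_ : fine _ = 0%R).
  by rewrite invr0 mul0e.
by case/orP: nuB => [|/eqP->//]; rewrite measure_le0 => /eqP->.
Qed.

Lemma fine_measureM_AvE g : nu B < +oo ->
  (fine (nu B))%:E * avg g = \int[nu]_(x in B) g x.
Proof.
move=> nuB; rewrite avgE muleA -EFinM.
have [nu0|nu_neq0] := eqVneq (fine (nu B)) 0%R; last by rewrite divff// mul1e.
rewrite nu0 mul0r mul0e integral_null_set//.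
by rewrite -(fineK (x := nu B)) ?nu0// ge0_fin_numE.
Qed.

Lemma AvE_le_root p s g : (1 < p)%R -> (0 < s)%R ->
  (forall x, B x -> 0 <= g x) -> measurable_fun B g ->
  avg (fun x => g x `^ p) <= (s `^ p)%:E -> avg g <= s%:E.
Proof.
move=> p1 s0 g0 mg gps; have p0 : (0 < p)%R by rewrite (lt_trans ltr01).
have q0 : 0 <= ((1 - p^-1) * s)%:E.
  by rewrite lee_fin mulr_ge0 ?subr_ge0 ?invf_le1//; exact: ltW.
have b0 : (0 <= p^-1 * s `^ (1 - p))%R by rewrite mulr_ge0 ?powR_ge0// invr_ge0 ltW.
have mgp : measurable_fun B (fun x => g x `^ p).
  exact: (measurableT_comp (measurable_poweR p)).
apply: (@le_trans _ _ (avg (fun x => ((1 - p^-1) * s)%:E +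
    (p^-1 * s `^ (1 - p))%:E * g x `^ p))).
  by apply: AvE_le => // x Bx; apply: le_poweR_tangent => //; exact: g0.
rewrite AvED//; last 2 first.
- by move=> x _; rewrite mule_ge0// poweR_ge0.
- exact: emeasurable_funM.
rewrite AvEZl//; last by move=> x _; exact: poweR_ge0.
apply: (le_trans (leeD (AvE_cst_le q0) (lee_wpmul2l _ gps))); first by rewrite lee_fin.
rewrite -EFinM -EFinD lee_fin -mulrA -powRD ?(gt_eqF s0) ?implybT// subrK.
by rewrite powRr1 ?(ltW s0)// -mulrDl subrK mul1r.
Qed.

Lemma AvE_poweR_le p g : (1 < p)%R -> (forall x, B x -> 0 <= g x) ->
  measurable_fun B g -> avg g `^ p <= avg (fun x => g x `^ p).
Proof.
move=> p1 g0 mg; have p0 : (0 < p)%R by rewrite (lt_trans ltr01).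
set u := leRHS; have u0 : 0 <= u by apply: AvE_ge0 => x _; exact: poweR_ge0.
apply/lee_addgt0Pr => e e0; have [uy|uy] := eqVneq u +oo.
  by rewrite uy addye// leey.
have uE : u = (fine u)%:E by rewrite fineK// ge0_fin_numE// ltey.
have s0 : (0 < fine u + e)%R by rewrite ltr_wpDl// fine_ge0.
have rootK : ((fine u + e) `^ p^-1 `^ p = fine u + e)%R.
  by rewrite -powRrM mulVf ?gt_eqF// powRr1// ltW.
rewrite uE -EFinD -rootK -poweR_EFin.
apply: lee_poweR; [exact: ltW|exact: AvE_ge0|apply: (AvE_le_root p1) => //].
  by rewrite powR_gt0.
by rewrite rootK -/u uE lee_fin lerDl ltW.
Qed.

End MeasureAverages.

Section MeasurableAverages.
Context {R : realType} {d d' : measure_display} {T : measurableType d'}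
  {X : measurableType d}.
Variable nu : {sigma_finite_measure set X -> \bar R}.
Local Open Scope ereal_scope.
Local Notation avg := (AvE nu (mu_int nu)).

Lemma measurable_AvE_xsection (A : set (T * X)) (f : T * X -> \bar R) :
  measurable A -> (forall z, 0 <= f z) -> measurable_fun setT f ->
  measurable_fun setT (fun x => avg (xsection A x) (fun y => f (x, y))).
Proof.
move=> mA f0 mf; under eq_fun do rewrite AvEE//.
apply: emeasurable_funM; last exact: measurable_integral_xsection.
apply/measurable_EFinP.
under eq_fun do rewrite -(powR_inv1 (fine_ge0 (measure_ge0 nu _))).
apply: (measurableT_comp (measurable_powR (-1))).
exact: (measurableT_comp (fine_measurable measurableT) (measurable_fun_xsection nu mA)).
Qed.

Lemma measurable_AvE_prod (B : set X) (f : T * X -> \bar R) : measurable B ->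
  (forall z, 0 <= f z) -> measurable_fun setT f ->
  measurable_fun setT (fun x => avg B (fun y => f (x, y))).
Proof.
move=> mB f0 mf; have := measurable_AvE_xsection (measurableX measurableT mB) f0 mf.
by under eq_fun do rewrite in_xsectionX ?inE//.
Qed.

End MeasurableAverages.

Section Oscillation.
Context {R : realType} {d d' : measure_display} {T : measurableType d'}
  {X : measurableType d}.
Variable F : X -> R.
Hypothesis mF : measurable_fun setT F.
Local Open Scope ereal_scope.

Let measurable_distance c B : measurable_fun B (fun x => (`|F x - c|)%:E).
Proof.
apply/measurable_EFinP/measurableT_comp => //; apply: measurable_funB => //.
exact: measurable_funTS.
Qed.

Lemma measurable_pair_dist : measurable_fun setT (fun z : X * X => `|F z.1 - F z.2|)%R.
Proof.
apply: measurableT_comp => //; apply: measurable_funB.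
  exact: measurableT_comp mF measurable_fst.
exact: measurableT_comp mF measurable_snd.
Qed.

Lemma oscE_ratr (nu : {measure set X -> \bar R}) (B : set X) : measurable B ->
  oscE nu (mu_int nu) F B = ereal_inf
    [set AvE nu (mu_int nu) B (fun x => (`|F x - ratr q|)%:E) | q in [set: rat]].
Proof.
move=> mB; apply/eqP; rewrite eq_le; apply/andP; split.
  by apply: le_ereal_inf => _ [q _ <-]; exists (ratr q).
apply: le_ereal_inf_tmp => _ [c _ <-]; apply/lee_addgt0Pr => e e0.
have [q] : exists q, (ratr q \in `]c, c + e[)%R by apply: rat_in_itvoo; rewrite ltrDl.
rewrite in_itv/= => /andP[cq qce].
apply: ge_ereal_inf; exists (AvE nu (mu_int nu) B (fun x => (`|F x - ratr q|)%:E)).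
  by exists q.
apply: (@le_trans _ _ (AvE nu (mu_int nu) B (fun x => (`|F x - c|)%:E + e%:E))).
  apply: AvE_le => // x _; rewrite -EFinD lee_fin.
  rewrite -[in leLHS](subrKA c) (le_trans (ler_normD _ _))// lerD2l.
  by rewrite distrC ger0_norm; lra.
rewrite AvED//; last by move=> x _; rewrite lee_fin ltW.
by rewrite leeD2l// AvE_cst_le// ltW.
Qed.

Lemma measurable_oscE_xsection (nu : {sigma_finite_measure set X -> \bar R})
    (A : set (T * X)) : measurable A ->
  measurable_fun setT (fun x => oscE nu (mu_int nu) F (xsection A x)).
Proof.
move=> mA; pose U n x := AvE nu (mu_int nu) (xsection A x)
  (fun y => (`|F y - ratr (odflt 0%R (unpickle n))|)%:E).
rewrite (_ : (fun x => _) = fun x => einfs (U ^~ x) 0%N).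
  apply: measurable_fun_einfs => n.
  pose f (z : T * X) : \bar R := (`|F z.2 - ratr (odflt 0%R (unpickle n))|)%:E.
  apply: (@measurable_AvE_xsection _ _ _ _ _ nu A f) => //.
    by move=> z; rewrite lee_fin.
  apply/measurable_EFinP/measurableT_comp => //; apply: measurable_funB => //.
  exact: measurableT_comp mF measurable_snd.
apply/funext => x; rewrite oscE_ratr; last exact: measurable_xsection.
congr ereal_inf; apply/seteqP; split => [_ [q _ <-]|_ [n _ <-]].
  by exists (pickle q) => //=; rewrite /U pickleK.
by exists (odflt 0%R (unpickle n)).
Qed.

Lemma AvE_dist_triangle (nu : {measure set X -> \bar R})
    (nu' : {sigma_finite_measure set X -> \bar R}) (B : set X) (c : R) :
  measurable B -> 0 < nu B < +oo ->
  AvE nu' (mu_int nu') B (fun z => (`|F z - c|)%:E) <=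
  AvE nu (mu_int nu) B (fun y => (`|F y - c|)%:E) +
  AvE nu (mu_int nu) B (fun y => AvE nu' (mu_int nu') B (fun z => (`|F y - F z|)%:E)).
Proof.
move=> mB nuB; set V := AvE nu' _ _ _.
have V0 : 0 <= V by apply: AvE_ge0.
have mD : measurable_fun setT
    (fun y => AvE nu' (mu_int nu') B (fun z => (`|F y - F z|)%:E)).
  apply: (@measurable_AvE_prod _ _ _ _ _ nu' B (fun z => (`|F z.1 - F z.2|)%:E)) => //.
  by apply/measurable_EFinP; exact: measurable_pair_dist.
have D0 y : 0 <= AvE nu' (mu_int nu') B (fun z => (`|F y - F z|)%:E) by exact: AvE_ge0.
rewrite -AvED//; last exact: measurable_funTS.
have V_le y : V <= (`|F y - c|)%:E + AvE nu' (mu_int nu') B (fun z => (`|F y - F z|)%:E).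
  apply: (@le_trans _ _ (AvE nu' (mu_int nu') B
      (fun z => (`|F y - F z|)%:E + (`|F y - c|)%:E))).
    apply: AvE_le => // z _; rewrite -EFinD lee_fin (distrC (F y) (F z)).
    by rewrite (le_trans _ (ler_normD _ _))// subrKA.
  rewrite AvED//; last first.
    apply/measurable_EFinP/measurableT_comp => //; apply: measurable_funB => //.
    exact: measurable_funTS.
  by rewrite addeC leeD2r// AvE_cst_le.
by rewrite -(AvE_cst mB V nuB); exact: AvE_le.
Qed.

End Oscillation.

Section WeightedAverages.
Context {R : realType} {d : measure_display} {X : measurableType d} {I : finType}.
Variable a : I -> R.

Definition weighted_mass (nu : I -> set X -> \bar R) (G : set X) : \bar R :=
  (\sum_j (a j)%:E * nu j G)%E.

Definition weighted_integral (nu : I -> set X -> \bar R) (G : set X)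
    (g : X -> \bar R) : \bar R :=
  (\sum_j (a j)%:E * \int[nu j]_(x in G) g x)%E.

Hypothesis a_gt0 : forall j, 0 < a j.
Variables (nu : I -> {sigma_finite_measure set X -> \bar R}) (B : set X).
Hypotheses (mB : measurable B) (nu_lty : forall j, (nu j B < +oo)%E).
Local Open Scope ereal_scope.
Local Notation avg j := (AvE (nu j) (mu_int (nu j)) B).
Local Notation wavg := (AvE (weighted_mass nu) (weighted_integral nu) B).
Local Notation wosc F := (oscE (weighted_mass nu) (weighted_integral nu) F B).

Let mass j := fine (nu j B).

Let total := fine (weighted_mass nu B).

Let mass_ge0 j : (0 <= mass j)%R. Proof. exact: fine_ge0. Qed.

Let totalE : total = (\sum_j a j * mass j)%R.
Proof.
rewrite /total /weighted_mass (eq_bigr (fun j => (a j * mass j)%:E)) ?sumEFin// => j _.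
by rewrite EFinM fineK// ge0_fin_numE.
Qed.

Let total_ge0 : (0 <= total)%R.
Proof. by rewrite totalE sumr_ge0// => j _; rewrite mulr_ge0// ltW. Qed.

Let weighted_mass_ge0 : 0 <= weighted_mass nu B.
Proof. by apply: sume_ge0 => j _; rewrite mule_ge0// lee_fin ltW. Qed.

Lemma oscE_weighted_ge0 F : 0 <= wosc F.
Proof.
apply: oscE_ge0 => // g g0; apply: sume_ge0 => j _.
by rewrite mule_ge0 ?integral_ge0// lee_fin ltW.
Qed.

Let share j := (a j * mass j / total)%R.

Let share_bounds j : (0 <= share j <= 1)%R.
Proof.
have an0 i : (0 <= a i * mass i)%R by rewrite mulr_ge0// ltW.
rewrite /share divr_ge0//=; have [->|total_neq0] := eqVneq total 0%R.
  by rewrite invr0 mulr0.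
rewrite ler_pdivrMr ?lt_def ?total_neq0// mul1r totalE (bigD1 j)//= lerDl.
exact: sumr_ge0.
Qed.

Lemma AvE_weightedE g : (forall x, 0 <= g x) ->
  wavg g = \sum_j (share j)%:E * avg j g.
Proof.
move=> g0; rewrite AvEE// ge0_sume_distrr; last first.
  by move=> j _; rewrite mule_ge0 ?integral_ge0// lee_fin ltW.
apply: eq_bigr => j _; rewrite /share -(fine_measureM_AvE mB _ (nu_lty j)) !muleA -!EFinM.
by congr (_%:E * _); rewrite [RHS]mulrC mulrA.
Qed.

Let shareM_AvE j g :
  (share j)%:E * avg j g = (a j / total)%:E * \int[nu j]_(x in B) g x.
Proof.
by rewrite -(fine_measureM_AvE mB _ (nu_lty j)) muleA -EFinM /share -/(mass j) mulrAC.
Qed.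

Lemma AvE_weighted_poweR_le p g : (1 < p)%R -> (forall x, 0 <= g x) ->
  measurable_fun B g ->
  wavg g `^ p <= (#|I|%:R `^ p)%:E *
    \sum_j (a j / total)%:E * \int[nu j]_(x in B) (g x `^ p).
Proof.
move=> p1 g0 mg; rewrite AvE_weightedE//.
apply: (le_trans (poweR_combination_le (ltW p1) share_bounds _)).
  by move=> j; exact: AvE_ge0.
apply: lee_wpmul2l; first by rewrite lee_fin powR_ge0.
apply: lee_sum => j _; rewrite -shareM_AvE; apply: lee_wpmul2l.
  by rewrite lee_fin; case/andP: (share_bounds j).
exact: AvE_poweR_le.
Qed.

Section OscillationComparison.
Variables (F : X -> R) (i : I).
Hypotheses (mF : measurable_fun setT F) (nui_gt0 : 0 < nu i B).
Local Notation osc j := (oscE (nu j) (mu_int (nu j)) F B).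

Let mean_dist j := avg i (fun y => avg j (fun z => (`|F y - F z|)%:E)).

Let mean_dist_ge0 j : 0 <= mean_dist j.
Proof. by apply: AvE_ge0 => // y _; exact: AvE_ge0. Qed.

Let osc_ge0 : 0 <= osc i.
Proof. by apply: oscE_ge0 => // g g0; exact: integral_ge0. Qed.

Let sum_share : (\sum_j share j = 1)%R.
Proof.
rewrite -mulr_suml -totalE divff// gt_eqF// totalE (bigD1 i)//= ltr_pwDl//.
  rewrite mulr_gt0// fine_gt0// nui_gt0; exact: nu_lty.
by rewrite sumr_ge0// => j _; rewrite mulr_ge0// ltW.
Qed.

Lemma oscE_weighted_le :
  wosc F <= osc i + \sum_(j | j != i) (share j)%:E * mean_dist j.
Proof.
set V := \sum_(j | _) _.
have sV j : 0 <= (share j)%:E * mean_dist j.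
  by rewrite mule_ge0// lee_fin; case/andP: (share_bounds j).
have V0 : 0 <= V by exact: sume_ge0.
have [->|Vy] := eqVneq V +oo.
  by rewrite addey ?leey// gt_eqF// (lt_le_trans _ osc_ge0).
have Vfin : V \is a fin_num by rewrite ge0_fin_numE// ltey.
rewrite -leeBlDr//; apply: le_ereal_inf_tmp => _ [c _ <-]; rewrite leeBlDr//.
apply: (@le_trans _ _ (wavg (fun x => (`|F x - c|)%:E))).
  by apply: ereal_inf_lbound; exists c.
rewrite AvE_weightedE//; set U := avg i _.
have U0 : 0 <= U by exact: AvE_ge0.
have share_ge0 j : 0 <= (share j)%:E by rewrite lee_fin; case/andP: (share_bounds j).
apply: (@le_trans _ _ (\sum_j ((share j)%:E * U +
    if j != i then (share j)%:E * mean_dist j else 0))).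
  apply: lee_sum => j _; have [->|ji] /= := eqVneq j i; first by rewrite adde0.
  rewrite -ge0_muleDr//; apply: lee_wpmul2l => //.
  by apply: AvE_dist_triangle => //; rewrite nui_gt0 nu_lty.
by rewrite big_split/= -big_mkcond -ge0_sume_distrl// sumEFin sum_share mul1e.
Qed.

Let mean_dist_poweR_le p j : (1 < p)%R ->
  (share j)%:E * mean_dist j `^ p <=
  (a j / total)%:E * avg i (fun y => \int[nu j]_(z in B) (`|F y - F z| `^ p)%:E).
Proof.
move=> p1; have share_ge0 : (0 <= share j)%R by case/andP: (share_bounds j).
pose h (z : X * X) : \bar R := (`|F z.1 - F z.2|)%:E.
have h0 z : 0 <= h z by rewrite lee_fin.
have mh : measurable_fun setT h by apply/measurable_EFinP; exact: measurable_pair_dist.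
pose hp (z : X * X) : \bar R := (`|F z.1 - F z.2| `^ p)%:E.
have mhp : measurable_fun setT hp.
  apply/measurable_EFinP; apply: (measurableT_comp (measurable_powR p)).
  exact: measurable_pair_dist.
have hp0 z : 0 <= hp z by rewrite lee_fin powR_ge0.
have jensen : mean_dist j `^ p <= avg i (fun y => avg j (fun z => hp (y, z))).
  have avg_ge0 y : 0 <= avg j (fun z => h (y, z)) by exact: AvE_ge0.
  have mavg : measurable_fun B (fun y => avg j (fun z => h (y, z))).
    by apply: measurable_funTS; exact: measurable_AvE_prod.
  apply: (le_trans (AvE_poweR_le (nu i) mB p1 (fun y _ => avg_ge0 y) mavg)).
  apply: AvE_le => // y _; first exact: poweR_ge0.
  apply: AvE_poweR_le => //; apply: measurable_funTS.
  exact: (measurableT_comp mh (pair1_measurable y)).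
apply: (le_trans (lee_wpmul2l _ jensen)); first by rewrite lee_fin.
under [in leRHS]eq_fun do rewrite -(fine_measureM_AvE mB _ (nu_lty j)).
rewrite AvEZl//; last 2 first.
- by move=> y _; exact: AvE_ge0.
- by apply: measurable_funTS; exact: (measurable_AvE_prod (nu j) mB hp0 mhp).
by rewrite muleA -EFinM mulrAC.
Qed.

Lemma oscE_weighted_poweR_le p : (1 < p)%R ->
  wosc F `^ p <= (#|I|%:R `^ p)%:E * (osc i `^ p +
    \sum_(j | j != i) (a j / total)%:E *
      avg i (fun y => \int[nu j]_(z in B) (`|F y - F z| `^ p)%:E)).
Proof.
move=> p1; have p0 : (0 < p)%R by rewrite (lt_trans ltr01).
pose c j : R := if j == i then 1%R else share j.
pose x j := if j == i then osc i else mean_dist j.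
have c_bounds j : (0 <= c j <= 1)%R by rewrite /c; case: ifP => //; rewrite ler01 lexx.
have x_ge0 j : 0 <= x j by rewrite /x; case: ifP.
have woscE : wosc F <= \sum_j (c j)%:E * x j.
  apply: (le_trans oscE_weighted_le); rewrite [leRHS](bigD1 i)//= {1}/c {1}/x eqxx mul1e.
  by rewrite leeD2l//; apply: lee_sum => j /negPf ji; rewrite /c /x ji.
apply: (le_trans (lee_poweR (ltW p0) (oscE_weighted_ge0 F) woscE)).
apply: (le_trans (poweR_combination_le (ltW p1) c_bounds x_ge0)).
apply: lee_wpmul2l; first by rewrite lee_fin powR_ge0.
rewrite (bigD1 i)//= {1}/c {1}/x eqxx mul1e leeD2l//.
by apply: lee_sum => j /negPf ji; rewrite /c /x ji; exact: mean_dist_poweR_le.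
Qed.

End OscillationComparison.
End WeightedAverages.

(** * Borel sets and null sets of a separable metric space *)

Section MetricBorel.
Context {R : realType} {d0 : measure_display} {X : measurableType d0}.
Variable dist : X -> X -> R.
Hypotheses (dm : is_metric dist) (dsep : dseparable dist)
  (dbor : borel_sets dist).
Implicit Types (x y : X) (r e : R).

Lemma measurable_dopen (A : set X) : dopen dist A -> measurable A.
Proof. by move=> oA; rewrite dbor; exact: sub_sigma_algebra. Qed.

Lemma measurable_dclosed (A : set X) : dclosed dist A -> measurable A.
Proof.
move=> cA; rewrite -[A]setCK; apply: measurableC; apply: measurable_dopen.
move=> x nAx; apply: contrapT => no_ball; apply: nAx; apply: cA => e e0.
apply: contrapT => far; apply: no_ball; exists e => // y /= xy Ay.
by apply: far; exists y.
Qed.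

Lemma measurable_cball x r : measurable (cball dist x r).
Proof.
have [_ _ dC dT] := dm.
apply: measurable_dclosed => y ye; apply/ler_addgt0Pr => e e0.
have [z xz yz] := ye _ e0; rewrite (le_trans (dT x z y))// lerD//.
by rewrite dC ltW.
Qed.

Lemma measurable_dball x r : measurable [set y | dist x y < r].
Proof.
have [_ _ _ dT] := dm.
apply: measurable_dopen => y /= xy; exists (r - dist x y); first by rewrite subr_gt0.
by move=> z /= yz; rewrite (le_lt_trans (dT x y z))// -ltrBrDl.
Qed.

(* The possibly empty space is why points of a dense sequence come as sets. *)
Lemma dense_sequence : exists2 u : nat -> set X,
  (forall n, u n = set0 \/ exists x, u n = [set x]) &
  (forall x e, 0 < e -> exists n, exists2 y, u n y & dist x y < e).
Proof.
have [D [/countable_injP[g g_inj] denseD]] := dsep.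
exists (fun n => D `&` g @^-1` [set n]).
  move=> n; have [[x [Dx gx]]|noD] := pselect (exists x, D x /\ g x = n); last first.
    by left; apply/seteqP; split => // x [Dx gx]; apply: noD; exists x.
  right; exists x; apply/seteqP; split => [y [Dy gy]|y ->] //=.
  by apply: g_inj; rewrite ?inE// gy.
by move=> x e e0; have [y Dy xy] := denseD x e e0; exists (g y); exists y.
Qed.

Lemma cball_cover r : 0 < r -> exists2 F : nat -> set X,
  (forall n, F n = set0 \/ exists x, F n = cball dist x r) &
  \bigcup_n F n = setT.
Proof.
have [_ _ dC _] := dm.
move=> r0; have [u u1 u_dense] := dense_sequence.
exists (fun n => \bigcup_(x in u n) cball dist x r).
  move=> n; have [->|[x ->]] := u1 n; first by left; rewrite bigcup_set0.
  by right; exists x; rewrite bigcup_set1.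
apply/seteqP; split => // x _; have [n [y uy xy]] := u_dense x _ r0.
by exists n => //; exists y => //; rewrite /cball/= dC ltW.
Qed.

Lemma sigma_finite_cball (nu : {measure set X -> \bar R}) r : 0 < r ->
  (forall x, nu (cball dist x r) < +oo)%E -> sigma_finite setT nu.
Proof.
move=> r0 nu_lty; have [F FE FT] := cball_cover r0; exists F => // n.
have [->|[x ->]] := FE n; first by rewrite measure0.
by split; [exact: measurable_cball|exact: nu_lty].
Qed.

Lemma null_set_cball (nu : {measure set X -> \bar R}) r (A : set X) : 0 < r ->
  measurable A -> (forall x, nu (cball dist x r `&` A) = 0)%E -> nu A = 0%E.
Proof.
move=> r0 mA nu0; have [F FE FT] := cball_cover r0.
have mF n : measurable (F n).
  by have [->|[x ->]] := FE n => //; exact: measurable_cball.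
apply: (measure_negligible mA); rewrite -[A]setTI -FT setI_bigcupl.
apply: negligible_bigcup => n.
apply/negligibleP; first exact: measurableI.
have [->|[x ->]] := FE n; last exact: nu0.
by rewrite set0I measure0.
Qed.

Lemma measurable_dist_le r : measurable [set z : X * X | dist z.1 z.2 <= r].
Proof.
have [_ _ dC dT] := dm.
have [u u1 u_dense] := dense_sequence.
rewrite (_ : [set _ | _] = \bigcap_m \bigcup_n \bigcup_(q in u n)
    ([set x | dist q x < m.+1%:R^-1] `*` cball dist q (r + m.+1%:R^-1))).
  apply: bigcapT_measurable => m; apply: bigcupT_measurable => n.
  have [->|[q ->]] := u1 n; first by rewrite bigcup_set0.
  rewrite bigcup_set1; apply: measurableX; first exact: measurable_dball.
  exact: measurable_cball.
apply/seteqP; split => -[x y] /=.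
  move=> xy m _; have m0 : 0 < m.+1%:R^-1 :> R by rewrite invr_gt0.
  have [n [q uq xq]] := u_dense x _ m0; exists n => //; exists q => //.
  rewrite /cball /= dC; split => //; rewrite (le_trans (dT q x y))// addrC lerD//.
  by rewrite dC ltW.
move=> near; apply/ler_addgt0Pr => e e0.
have e20 : 0 < e / 2 by rewrite divr_gt0.
have [m _ /(_ m (leqnn m)) m_lt] := near_infty_natSinv_lt (PosNum e20).
have [n _ [q _ [/= qx qy]]] := near m I; have := dT x q y.
move: m_lt qx qy; rewrite /cball /= (dC q x); move: (m.+1%:R^-1 : R) => t; lra.
Qed.

Lemma xsection_dist_le x r :
  xsection [set z : X * X | dist z.1 z.2 <= r] x = cball dist x r.
Proof. by rewrite xsectionE. Qed.

Lemma ysection_dist_le x r :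
  ysection [set z : X * X | dist z.1 z.2 <= r] x = cball dist x r.
Proof.
have [_ _ dC _] := dm; rewrite ysectionE.
by apply/seteqP; split => y /=; rewrite /cball /= dC.
Qed.

End MetricBorel.

(** * Doubling measures and codimension *)

Section Regularity.
Context {R : realType} {d0 : measure_display} {X : measurableType d0}.
Variables (dist : X -> X -> R) (mu : set X -> \bar R).
Implicit Types (th r C : R) (S : set X).
Local Notation ball := (cball dist).

Definition doubling_near C : Prop := forall x y r, 0 < r <= 1 -> dist x y <= 2 * r ->
  (mu (ball y (2 * r)) <= C%:E * mu (ball x r))%E.

Definition codim_regular th S (nu : set X -> \bar R) C : Prop :=
  (forall x r, S x -> 0 < r <= 1 ->
     ((r `^ (- th))%:E * mu (ball x r) <= C%:E * nu (ball x r))%E) /\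
  (forall x r, 0 < r <= 2^-1 ->
     (nu (ball x r) <= (C * r `^ (- th))%:E * mu (ball x r))%E).

End Regularity.

Section Codimension.
Context {R : realType} {d0 : measure_display} {X : measurableType d0}.
Variables (dist : X -> X -> R) (mu : {measure set X -> \bar R}).
Hypotheses (dm : is_metric dist) (dbor : borel_sets dist).
Implicit Types (th r C : R) (S E : set X).
Local Notation ball := (cball dist).

Lemma doubling_near_le C C' : C <= C' ->
  doubling_near dist mu C -> doubling_near dist mu C'.
Proof.
move=> CC' dblC x y r r1 xy; apply: (le_trans (dblC x y r r1 xy)).
by apply: lee_wpmul2r; rewrite ?lee_fin.
Qed.

Lemma codim_regular_le th S (nu : {measure set X -> \bar R}) C C' : C <= C' ->
  codim_regular dist mu th S nu C -> codim_regular dist mu th S nu C'.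
Proof.
move=> CC' [lower upper]; split=> [x r Sx r1|x r r2].
  apply: (le_trans (lower x r Sx r1)); apply: lee_wpmul2r; rewrite ?lee_fin//.
apply: (le_trans (upper x r r2)); apply: lee_wpmul2r; rewrite ?lee_fin//.
by rewrite ler_wpM2r// powR_ge0.
Qed.

Lemma cball_lty : locally_finite dist mu -> unif_loc_doubling dist mu ->
  forall x r, (mu (ball x r) < +oo)%E.
Proof.
move=> lf dbl x r; have [s s0 s_lty] := lf x.
have double_lty (t : R) : 0 < t -> (mu (ball x t) < +oo)%E ->
    (mu (ball x (2 * t)) < +oo)%E.
  move=> t0 t_lty; have [C dblC] := dbl t t0.
  apply: (le_lt_trans (dblC x t _)); first by rewrite t0 lexx.
  by rewrite -(fineK (x := mu (ball x t))) ?ge0_fin_numE// -EFinM ltry.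
have iter_lty n : (mu (ball x (2 ^+ n * s)) < +oo)%E.
  elim: n => [|n IHn]; first by rewrite expr0 mul1r.
  by rewrite exprS -mulrA; apply: double_lty => //; rewrite mulr_gt0// exprn_gt0.
have [n rn] : exists n, r <= 2 ^+ n * s.
  exists (Num.truncn `|r / s|).+1; rewrite -ler_pdivrMr//.
  apply: (le_trans (ler_norm _)); apply: ltW; apply: (lt_trans (truncnS_gt _)).
  by rewrite -natrX ltr_nat ltn_expl.
apply: le_lt_trans (iter_lty n); apply: le_measure; rewrite ?inE.
- exact: measurable_cball.
- exact: measurable_cball.
- by move=> y /= /le_trans; apply.
Qed.

Lemma unif_loc_doubling_near : unif_loc_doubling dist mu ->
  exists2 C : R, 1 <= C & doubling_near dist mu C.
Proof.
have [_ _ _ dT] := dm.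
move=> dbl; have [C0 dblC0] := dbl 2 (ltr0n _ 2).
pose C := Num.max 1 C0; have C1 : 1 <= C by rewrite le_max lexx.
have dblC x r : 0 < r <= 2 -> (mu (ball x (2 * r)) <= C%:E * mu (ball x r))%E.
  move=> r2; apply: (le_trans (dblC0 x r r2)); apply: lee_wpmul2r => //.
  by rewrite lee_fin le_max lexx orbT.
exists (C * C); first by rewrite -[leLHS]mulr1 ler_pM.
move=> x y r /andP[r0 r1] xy.
apply: (@le_trans _ _ (mu (ball x (2 * (2 * r))))).
  apply: le_measure; rewrite ?inE; [exact: measurable_cball..|].
  rewrite /cball => z /= yz; apply: (le_trans (dT x y z)); lra.
apply: (le_trans (dblC _ _ _)); first by apply/andP; split; lra.
rewrite EFinM -muleA; apply: lee_wpmul2l; first by rewrite lee_fin (le_trans ler01).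
by apply: dblC; apply/andP; split; lra.
Qed.

Lemma le_Hcont_delta th del E : 0 < th -> 0 < del -> measurable E ->
  (mu E <= (del `^ th)%:E * Hcont_delta dist mu th del E)%E.
Proof.
move=> th0 del0 mE; rewrite -lee_pdivrMl ?powR_gt0//.
apply: le_ereal_inf_tmp => _ [I [x [r [EI [rI ->]]]]].
have term_ge0 i : (0 <= mu (ball (x i) (r i)) * (r i `^ (- th))%:E)%E.
  by rewrite mule_ge0// lee_fin powR_ge0.
rewrite lee_pdivrMl ?powR_gt0// esum_mkcond -nneseries_esumT -?nneseriesZl; last 2 first.
- by move=> i _; case: ifP.
- by move=> i; case: ifP.
pose F i := if i \in I then ball (x i) (r i) else set0.
have mF i : measurable (F i) by rewrite /F; case: ifP => // _; exact: measurable_cball.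
apply: (@le_trans _ _ (\sum_(0 <= i <oo) mu (F i))%E).
  apply: measure_sigma_subadditive => // y Ey.
  by have [i Ii yi] := EI y Ey; exists i => //; rewrite /F mem_set.
apply: lee_nneseries => // i _; rewrite /F.
case: ifPn => [/set_mem Ii|_]; last by rewrite measure0 mule0.
rewrite muleCA -[leLHS]mule1; apply: lee_wpmul2l => //.
rewrite -EFinM lee_fin powRN; have /andP[r0 rd] := rI i Ii.
by rewrite ler_pdivlMr ?powR_gt0// mul1r ge0_ler_powR ?nnegrE ?ltW.
Qed.

Lemma Hcont_lty_null th E : 0 < th -> measurable E ->
  (Hcont dist mu th E < +oo)%E -> mu E = 0%E.
Proof.
move=> th0 mE Hfin.
have le_Hcont del : 0 < del -> (mu E <= (del `^ th)%:E * Hcont dist mu th E)%E.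
  move=> del0; apply: (le_trans (le_Hcont_delta th0 del0 mE)).
  apply: lee_wpmul2l; first by rewrite lee_fin powR_ge0.
  by apply: ereal_sup_ubound; exists del.
have H0 : (0 <= Hcont dist mu th E)%E.
  by have := le_Hcont 1 ltr01; rewrite powR1 mul1e; exact: le_trans.
have HE : Hcont dist mu th E = (fine (Hcont dist mu th E))%:E.
  by rewrite fineK// ge0_fin_numE.
move: HE le_Hcont (fine_ge0 H0) => ->; move: (fine _) => M le_M M0.
apply/eqP; rewrite -measure_le0; apply/lee_addgt0Pr => e e0; rewrite add0e.
have M1 : 0 < M + 1 by rewrite ltr_wpDl.
have := le_M ((e / (M + 1)) `^ th^-1).
rewrite powR_gt0 ?divr_gt0// => /(_ isT) /le_trans; apply.
rewrite -powRrM mulVf ?gt_eqF// powRr1; last by rewrite ltW// divr_gt0.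
rewrite -EFinM lee_fin -mulrA ler_piMr//; first exact: ltW.
by rewrite mulrC ler_pdivrMr// mul1r lerDl.
Qed.

Lemma ADR_upper th S (nu : {measure set X -> \bar R}) C : 0 < th -> 0 <= C ->
  doubling_near dist mu C -> ADR dist mu th S ->
  (forall A, measurable A -> nu A = Hcont dist mu th (A `&` S)) ->
  exists K : R, forall x r, 0 < r <= 2^-1 ->
    (nu (ball x r) <= (K * r `^ (- th))%:E * mu (ball x r))%E.
Proof.
have [_ _ dC dT] := dm.
move=> th0 C0 dblC [_ [k1 [k [_ [k0 regular]]]]] nuE.
exists (k * C) => x r /andP[r0 r2].
have [[y [xy Sy]]|noS] := pselect (ball x r `&` S !=set0); last first.
  have ball_S0 : ball x r `&` S = set0 by apply/eqP/negPn/negP => /set0P.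
  rewrite nuE ?ball_S0; last exact: measurable_cball.
  rewrite -(set0I S) -nuE// measure0 mule_ge0// lee_fin.
  by rewrite !mulr_ge0 ?powR_ge0// ltW.
move: xy; rewrite /cball /= => xy.
apply: (@le_trans _ _ (nu (ball y (2 * r)))).
  apply: le_measure; rewrite ?inE; [exact: measurable_cball..|].
  by move=> z; rewrite /cball /= => xz; rewrite (le_trans (dT y x z))// dC; lra.
rewrite nuE; last exact: measurable_cball.
have [|_ upper] := regular y (2 * r) Sy; first by apply/andP; split; lra.
apply: (le_trans upper); rewrite (mulrAC k) [in leRHS]EFinM -muleA.
apply: (@le_trans _ _ ((k * r `^ (- th))%:E * mu (ball y (2 * r)))%E).
  apply: lee_wpmul2r => //; rewrite lee_fin ler_pM2l// !powRN.
  by rewrite lef_pV2 ?posrE ?powR_gt0 ?ge0_ler_powR ?nnegrE//; lra.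
apply: lee_wpmul2l; first by rewrite lee_fin mulr_ge0 ?powR_ge0// ltW.
by apply: dblC; [apply/andP; split; lra|lra].
Qed.

Lemma ADR_codim_regular th S (nu : {measure set X -> \bar R}) : 0 < th ->
  unif_loc_doubling dist mu -> ADR dist mu th S ->
  (forall A, measurable A -> nu A = Hcont dist mu th (A `&` S)) ->
  exists C, codim_regular dist mu th S nu C.
Proof.
move=> th0 dbl SADR nuE; have [C0 C01 dblC0] := unif_loc_doubling_near dbl.
have [|K upper] := ADR_upper th0 _ dblC0 SADR nuE; first exact: le_trans ler01 C01.
have [_ [k [k' [k0 [_ regular]]]]] := SADR.
exists (Num.max k^-1 K); split=> [x r Sx r1|x r r2].
  apply: (@le_trans _ _ ((k^-1)%:E * nu (ball x r))%E); last first.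
    by apply: lee_wpmul2r => //; rewrite lee_fin le_max lexx.
  rewrite lee_pdivlMl// muleA -EFinM nuE; last exact: measurable_cball.
  exact: (regular x r Sx r1).1.
apply: (le_trans (upper x r r2)); apply: lee_wpmul2r => //.
by rewrite lee_fin ler_wpM2r ?powR_ge0// le_max lexx orbT.
Qed.

End Codimension.

Lemma exists_common_bound (R : realType) (I : finType) (P : I -> R -> Prop) :
  (forall i C C', C <= C' -> P i C -> P i C') -> (forall i, exists C, P i C) ->
  exists C, forall i, P i C.
Proof.
move=> P_le /choice[C PC]; exists (\sum_i `|C i|) => i; apply: P_le (PC i).
by rewrite (bigD1 i)//= (le_trans (ler_norm _))// lerDl sumr_ge0.
Qed.

Lemma exists_regularity_constant (R : realType) (d0 : measure_display)
    (X : measurableType d0) (dist : X -> X -> R) (mu : {measure set X -> \bar R})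
    (I : finType) (th : I -> R) (S : I -> set X)
    (H : I -> {measure set X -> \bar R}) (mS : forall i, measurable (S i)) :
  is_metric dist -> borel_sets dist -> unif_loc_doubling dist mu ->
  (forall i, 0 < th i) -> (forall i, ADR dist mu (th i) (S i)) ->
  (forall i A, measurable A -> H i A = Hcont dist mu (th i) A) ->
  exists C : R, [/\ 1 <= C, doubling_near dist mu C &
    forall i, codim_regular dist mu (th i) (S i) (mrestr (H i) (mS i)) C].
Proof.
move=> dm dbor dbl th0 SADR HE.
have [C C1 dblC] := unif_loc_doubling_near dm dbor dbl.
have [K regK] : exists K, forall i,
    codim_regular dist mu (th i) (S i) (mrestr (H i) (mS i)) K.
  apply: exists_common_bound => i; first exact: codim_regular_le.
  apply: (ADR_codim_regular dm dbor (th0 i) dbl (SADR i)) => A mA.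
  by rewrite -HE//; exact: measurableI.
exists (Num.max C K); split; first by rewrite le_max C1.
  by apply: doubling_near_le dblC; rewrite le_max lexx.
by move=> i; apply: codim_regular_le (regK i); rewrite le_max lexx orbT.
Qed.

(** * Averages over the balls of one radius *)

Section GluingDensity.
Context {R : realType} {d0 : measure_display} {X : measurableType d0}.
Variables (dist : X -> X -> R) (mu : set X -> \bar R).
Local Notation ball := (cball dist).

Definition ball_mass r x : R := fine (mu (ball x r)).

Definition gluing_weight t y z : R := (ball_mass t y * ball_mass t z) `^ (- 2^-1).

Definition gluing_density (F : X -> R) p (nu : set X -> \bar R) t y : \bar R :=
  (\int[nu]_(z in ball y t) (gluing_weight t y z * `|F y - F z| `^ p)%:E)%E.

End GluingDensity.

Section BallAverages.
Context {R : realType} {d0 : measure_display} {X : measurableType d0}.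
Variables (dist : X -> X -> R) (mu : {sigma_finite_measure set X -> \bar R}).
Hypotheses (dm : is_metric dist) (dsep : dseparable dist)
  (dbor : borel_sets dist).
Implicit Types (nu : {sigma_finite_measure set X -> \bar R}) (r t p : R).
Local Notation ball := (cball dist).
Local Notation ball_mass := (ball_mass dist mu).
Local Notation gluing_weight := (gluing_weight dist mu).
Local Notation gluing_density := (gluing_density dist mu).

Lemma measurable_ball_mass r : measurable_fun setT (ball_mass r).
Proof.
have := measurable_fun_xsection mu (measurable_dist_le dm dsep dbor r).
move=> /(measurableT_comp (fine_measurable measurableT)); congr measurable_fun.
by apply/funext => x; rewrite /= xsection_dist_le.
Qed.

Lemma measurable_inv_ball_mass r : measurable_fun setT (fun x => (ball_mass r x)^-1).
Proof.
under eq_fun => x do rewrite -(powR_inv1 (fine_ge0 (measure_ge0 mu _))).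
exact: (measurableT_comp (measurable_powR (-1)) (measurable_ball_mass r)).
Qed.

Lemma measurable_integral_cball nu r (f : X * X -> \bar R) :
  (forall z, 0 <= f z)%E -> measurable_fun setT f ->
  measurable_fun setT (fun x => \int[nu]_(y in ball x r) f (x, y))%E.
Proof.
move=> f0 mf; have := measurable_integral_xsection
  (measurable_dist_le dm dsep dbor r) f0 mf nu.
by under eq_fun do rewrite xsection_dist_le.
Qed.

Lemma measurable_oscE_cball nu (F : X -> R) r : measurable_fun setT F ->
  measurable_fun setT (fun x => oscE nu (mu_int nu) F (ball x r)).
Proof.
move=> mF; have := measurable_oscE_xsection mF nu (measurable_dist_le dm dsep dbor r).
by under eq_fun do rewrite xsection_dist_le.
Qed.

Lemma integral_ball_average nu nu' r (h : X -> \bar R) :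
  (forall x, 0 <= h x)%E -> measurable_fun setT h ->
  (\int[nu]_x (((ball_mass r x)^-1)%:E * \int[nu']_(y in ball x r) h y) =
   \int[nu']_y (h y * \int[nu]_(x in ball y r) ((ball_mass r x)^-1)%:E))%E.
Proof.
move=> h0 mh; have minv : measurable_fun setT (fun x => ((ball_mass r x)^-1)%:E).
  by apply/measurable_EFinP; exact: measurable_inv_ball_mass.
have inv0 x : (0 <= ((ball_mass r x)^-1)%:E)%E by rewrite lee_fin invr_ge0 fine_ge0.
have mB x : measurable (ball x r) by exact: measurable_cball.
pose f (z : X * X) := (((ball_mass r z.1)^-1)%:E * h z.2)%E.
have mf : measurable_fun setT f.
  apply: emeasurable_funM; first exact: measurableT_comp minv measurable_fst.
  exact: measurableT_comp mh measurable_snd.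
have f0 z : (0 <= f z)%E by exact: mule_ge0.
have fx x : (\int[nu']_(y in ball x r) f (x, y) =
    ((ball_mass r x)^-1)%:E * \int[nu']_(y in ball x r) h y)%E.
  by rewrite -ge0_integralZl//; exact: measurable_funTS.
have fy y : (\int[nu]_(x in ball y r) f (x, y) =
    h y * \int[nu]_(x in ball y r) ((ball_mass r x)^-1)%:E)%E.
  rewrite -ge0_integralZl//; last exact: measurable_funTS.
  by apply: eq_integral => x _; rewrite /f muleC.
have := fubini_tonelli_section (measurable_dist_le dm dsep dbor r) f0 mf nu nu'.
under eq_integral do rewrite xsection_dist_le fx.
by under [RHS]eq_integral do rewrite ysection_dist_le// fy.
Qed.

Section MeasurableGluingDensity.
Variables (F : X -> R) (p : R).
Hypothesis mF : measurable_fun setT F.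

Lemma gluing_density_ge0 (nu : {measure set X -> \bar R}) t y :
  (0 <= gluing_density F p nu t y)%E.
Proof. by apply: integral_ge0 => z _; rewrite lee_fin mulr_ge0// powR_ge0. Qed.

Lemma measurable_gluing_kernel t : measurable_fun setT
  (fun z : X * X => (gluing_weight t z.1 z.2 * `|F z.1 - F z.2| `^ p)%:E).
Proof.
apply/measurable_EFinP; apply: measurable_funM.
  apply: (measurableT_comp (measurable_powR _)); apply: measurable_funM.
    exact: measurableT_comp (measurable_ball_mass t) measurable_fst.
  exact: measurableT_comp (measurable_ball_mass t) measurable_snd.
apply: (measurableT_comp (measurable_powR p)); exact: measurable_pair_dist.
Qed.

Lemma measurable_gluing_density nu t : measurable_fun setT (gluing_density F p nu t).
Proof.
apply: (measurable_integral_cball nu t _ (measurable_gluing_kernel t)) => z.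
by rewrite lee_fin mulr_ge0// powR_ge0.
Qed.

End MeasurableGluingDensity.
End BallAverages.

(** * The oscillation energy at one scale *)

Section OneScale.
Context {R : realType} {d0 : measure_display} {X : measurableType d0} {I : finType}.
Variables (dist : X -> X -> R) (mu : {sigma_finite_measure set X -> \bar R}).
Hypotheses (dm : is_metric dist) (dsep : dseparable dist)
  (dbor : borel_sets dist).
Hypotheses (mu_lty : forall x r, (mu (cball dist x r) < +oo)%E)
  (mu_gt0 : forall x r, 0 < r -> (0 < mu (cball dist x r))%E).
Variables (th : I -> R) (S : I -> set X)
  (nu : I -> {sigma_finite_measure set X -> \bar R}).
Hypothesis mS : forall i, measurable (S i).
Variable C : R.
Hypotheses (C1 : 1 <= C) (dblC : doubling_near dist mu C)
  (regC : forall i, codim_regular dist mu (th i) (S i) (nu i) C).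
Variables (r q : R) (a : I -> R).
Hypotheses (r_half : 0 < r <= 2^-1) (q_gt0 : 0 < q) (aE : forall j, a j = q * r `^ th j).
Variables (F : X -> R) (p : R).
Hypotheses (mF : measurable_fun setT F) (p1 : 1 < p).
Local Notation ball x := (cball dist x r).
Local Notation m := (ball_mass dist mu r).
Local Notation gluing j := (gluing_density dist mu F p (nu j) (2 * r)).
Local Notation wosc x := (oscE (weighted_mass a nu) (weighted_integral a nu) F (ball x)).
Local Notation osc i x := (oscE (nu i) (mu_int (nu i)) F (ball x)).

Let C_gt0 : 0 < C. Proof. exact: lt_le_trans ltr01 C1. Qed.

Let r_gt0 : 0 < r. Proof. by case/andP: r_half. Qed.

Let r_bounds : 0 < r <= 1.
Proof. by case/andP: r_half => ? ?; apply/andP; split; lra. Qed.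

Let pow_r_gt0 t : 0 < r `^ t. Proof. exact: powR_gt0. Qed.

Let a_gt0 j : 0 < a j. Proof. by rewrite aE mulr_gt0. Qed.

Let mB x : measurable (ball x). Proof. exact: measurable_cball. Qed.

Let ball_massE t x : mu (cball dist x t) = (ball_mass dist mu t x)%:E.
Proof. by rewrite fineK// ge0_fin_numE. Qed.

Let m_gt0 x : 0 < m x. Proof. by rewrite -lte_fin -ball_massE mu_gt0. Qed.

Let ball_mass_double x y : dist x y <= r -> ball_mass dist mu (2 * r) y <= C * m x.
Proof.
move=> xy; rewrite -lee_fin EFinM -!ball_massE dblC//.
by have := r_gt0; move: xy; lra.
Qed.

Let ball_mass_near x y : dist x y <= r -> m y <= C * m x.
Proof.
move=> xy; apply: le_trans (ball_mass_double xy); rewrite -lee_fin -!ball_massE.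
apply: le_measure; rewrite ?inE; [exact: measurable_cball..|].
by move=> z /=; rewrite /cball/=; have := r_gt0; lra.
Qed.

Let nu_lty j x : (nu j (ball x) < +oo)%E.
Proof.
by apply: (le_lt_trans ((regC j).2 x r r_half)); rewrite ball_massE -EFinM ltry.
Qed.

Let trace_mass j x := fine (nu j (ball x)).

Let trace_massE j x : nu j (ball x) = (trace_mass j x)%:E.
Proof. by rewrite fineK// ge0_fin_numE. Qed.

Let trace_mass_lower i x : S i x -> r `^ (- th i) * m x <= C * trace_mass i x.
Proof.
by move=> Sx; rewrite -lee_fin !EFinM -ball_massE -trace_massE; exact: (regC i).1.
Qed.

Let trace_mass_upper i x : trace_mass i x <= C * r `^ (- th i) * m x.
Proof. by rewrite -lee_fin EFinM -ball_massE -trace_massE; exact: (regC i).2. Qed.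

Let trace_mass_gt0 i x : S i x -> 0 < trace_mass i x.
Proof.
move=> Sx; rewrite -(pmulr_rgt0 _ C_gt0); apply: lt_le_trans (trace_mass_lower Sx).
exact: mulr_gt0.
Qed.

Let weight_share_le i j x : S i x ->
  a j / fine (weighted_mass a nu (ball x)) <= C * r `^ th j / m x.
Proof.
move=> Sx.
have totalE : weighted_mass a nu (ball x) = (\sum_j a j * trace_mass j x)%:E.
  by rewrite -sumEFin; apply: eq_bigr => k _; rewrite trace_massE.
have weighted_ge0 k : 0 <= a k * trace_mass k x by rewrite mulr_ge0 ?fine_ge0// ltW.
have total_lower : q * m x <= C * fine (weighted_mass a nu (ball x)).
  rewrite totalE (bigD1 i)//=; apply: (@le_trans _ _ (C * (a i * trace_mass i x))).
    rewrite mulrCA (_ : q = a i * r `^ (- th i)) -?mulrA ?ler_pM2l ?trace_mass_lower//.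
    by rewrite aE powRN mulfK// gt_eqF.
  by rewrite ler_pM2l// lerDl sumr_ge0.
have total_gt0 : 0 < fine (weighted_mass a nu (ball x)).
  by rewrite -(pmulr_rgt0 _ C_gt0); apply: lt_le_trans total_lower; exact: mulr_gt0.
rewrite ler_pdivrMr// mulrAC ler_pdivlMr// aE.
have := ler_wpM2l (ltW (pow_r_gt0 (th j))) total_lower; lra.
Qed.

Let inv_trace_mass_le i x : S i x -> (trace_mass i x)^-1 <= C * r `^ th i / m x.
Proof.
move=> Sx; rewrite -[leLHS]div1r ler_pdivrMr ?trace_mass_gt0// mulrAC ler_pdivlMr// mul1r.
have := ler_wpM2l (ltW (pow_r_gt0 (th i))) (trace_mass_lower Sx).
by rewrite mulrA powRN mulfV ?gt_eqF// mul1r; lra.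
Qed.

Let integral_inv_ball_mass_le i y :
  (\int[nu i]_(x in ball y) ((m x)^-1)%:E <= (C ^+ 2 * r `^ (- th i))%:E)%E.
Proof.
have [_ _ dC _] := dm.
apply: (@le_trans _ _ (\int[nu i]_(x in ball y) (C / m y)%:E)%E).
  apply: ge0_le_integral_subset => // x xy; rewrite lee_fin.
  - by rewrite invr_ge0 ltW.
  - by rewrite divr_ge0// ltW.
  by rewrite ler_pdivlMr// mulrC ler_pdivrMr//; apply: ball_mass_near; rewrite dC.
rewrite integral_cst// [X in (_ * X <= _)%E](trace_massE i y) -EFinM lee_fin.
rewrite mulrAC ler_pdivrMr// expr2 -!mulrA ler_pM2l//.
by rewrite mulrA trace_mass_upper.
Qed.

Let integral_ball_average_le i (nu' : {sigma_finite_measure set X -> \bar R})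
    (h : X -> \bar R) :
  (forall x, 0 <= h x)%E -> measurable_fun setT h ->
  (\int[nu i]_x (((m x)^-1)%:E * \int[nu']_(y in ball x) h y) <=
   (C ^+ 2 * r `^ (- th i))%:E * \int[nu']_y h y)%E.
Proof.
move=> h0 mh; rewrite integral_ball_average// -ge0_integralZl//; last first.
  by rewrite lee_fin mulr_ge0 ?exprn_ge0 ?ltW.
apply: ge0_le_integral_subset => // y _.
- by rewrite mule_ge0 ?integral_ge0// => x _; rewrite lee_fin invr_ge0 ltW.
- by rewrite mule_ge0// lee_fin mulr_ge0 ?exprn_ge0 ?ltW.
by rewrite muleC; apply: lee_wpmul2r.
Qed.

Let gluing_weight_lower x y z : ball x y -> ball x z ->
  1 <= C * m x * gluing_weight dist mu (2 * r) y z.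
Proof.
move=> xy xz; have Cm0 : 0 < C * m x by exact: mulr_gt0.
have mass2_gt0 t : 0 < ball_mass dist mu (2 * r) t.
  by rewrite -lte_fin -ball_massE mu_gt0// mulr_gt0.
rewrite /gluing_weight powRN ler_pdivlMr ?powR_gt0 ?mulr_gt0// mul1r.
apply: (@le_trans _ _ (((C * m x) ^+ 2) `^ 2^-1)); last first.
  by rewrite powR12_sqrt ?sqr_ge0// sqrtr_sqr ger0_norm// ltW.
rewrite expr2; apply: ge0_ler_powR; rewrite ?nnegrE ?invr_ge0 ?(ltW (mulr_gt0 _ _))//.
by apply: ler_pM; rewrite ?ball_mass_double// ltW.
Qed.

Let integral_dist_pow_le j x y : ball x y ->
  (\int[nu j]_(z in ball x) (`|F y - F z| `^ p)%:E <= (C * m x)%:E * gluing j y)%E.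
Proof.
have [_ _ dC dT] := dm; move=> xy.
have ball_sub : ball x `<=` cball dist y (2 * r).
  move=> z xz; apply: (le_trans (dT y x z)); rewrite dC.
  by move: xy xz; rewrite /cball /=; lra.
have Cm0 : 0 <= C * m x by rewrite ltW// mulr_gt0.
have mk := measurableT_comp (measurable_gluing_kernel mu dm dsep dbor p mF (2 * r))
  (pair1_measurable y).
rewrite -ge0_integralZl//; first last.
- by move=> z _; rewrite lee_fin mulr_ge0 ?powR_ge0.
- exact: measurable_funTS mk.
- exact: measurable_cball.
apply: ge0_le_integral_subset => // [z _|z xz].
  by rewrite -EFinM lee_fin !mulr_ge0 ?powR_ge0// ltW.
by rewrite -EFinM lee_fin mulrA ler_peMl ?powR_ge0// gluing_weight_lower.
Qed.

Let AvE_gluing_le i j x : S i x ->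
  (AvE (nu i) (mu_int (nu i)) (ball x)
     (fun y => \int[nu j]_(z in ball x) (`|F y - F z| `^ p)%:E) <=
   (C ^+ 2 * r `^ th i)%:E * \int[nu i]_(y in ball x) gluing j y)%E.
Proof.
move=> Sx; rewrite AvEE//.
have Cm0 : 0 <= C * m x by rewrite ltW// mulr_gt0.
have mg : measurable_fun (ball x) (gluing j).
  by apply: measurable_funTS; exact: measurable_gluing_density.
have g0 y : (0 <= gluing j y)%E by exact: gluing_density_ge0.
apply: (@le_trans _ _ (((trace_mass i x)^-1)%:E *
    ((C * m x)%:E * \int[nu i]_(y in ball x) gluing j y))%E).
  apply: lee_wpmul2l; first by rewrite lee_fin invr_ge0 fine_ge0.
  rewrite -ge0_integralZl//; apply: ge0_le_integral_subset => // y xy.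
  - by apply: integral_ge0 => z _; rewrite lee_fin powR_ge0.
  - by rewrite mule_ge0.
  exact: integral_dist_pow_le.
rewrite muleA -EFinM; apply: lee_wpmul2r; first exact: integral_ge0.
rewrite lee_fin; apply: le_trans (ler_wpM2r Cm0 (inv_trace_mass_le Sx)) _.
by rewrite le_eqVlt; apply/orP; left; apply/eqP; field; rewrite gt_eqF.
Qed.

Lemma oscE_poweR_le_gluing i x : S i x ->
  (wosc x `^ p <= (#|I|%:R `^ p)%:E * (osc i x `^ p +
     \sum_(j | j != i) (C ^+ 3 * r `^ (th i + th j))%:E *
        (((m x)^-1)%:E * \int[nu i]_(y in ball x) gluing j y)))%E.
Proof.
move=> Sx; have nui : (0 < nu i (ball x))%E by rewrite trace_massE lte_fin trace_mass_gt0.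
apply: (le_trans (oscE_weighted_poweR_le a_gt0 (mB x) (nu_lty ^~ x) mF nui p1)).
apply: lee_wpmul2l; first by rewrite lee_fin powR_ge0.
rewrite leeD2l//; apply: lee_sum => j _.
have J0 : (0 <= \int[nu i]_(y in ball x) gluing j y)%E.
  by apply: integral_ge0 => y _; exact: gluing_density_ge0.
have Cr0 : 0 <= C ^+ 2 * r `^ th i by rewrite mulr_ge0 ?exprn_ge0 ?ltW.
have w0 : 0 <= a j / fine (weighted_mass a nu (ball x)).
  rewrite divr_ge0 ?fine_ge0 ?(ltW (a_gt0 _))//; apply: sume_ge0 => k _.
  by rewrite mule_ge0// lee_fin ltW.
apply: (le_trans (lee_wpmul2l _ (AvE_gluing_le j Sx))); first by rewrite lee_fin.
rewrite !muleA -!EFinM; apply: lee_wpmul2r => //; rewrite lee_fin.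
apply: (le_trans (ler_wpM2r Cr0 (weight_share_le j Sx))).
rewrite powRD ?(gt_eqF r_gt0) ?implybT//.
by rewrite le_eqVlt; apply/orP; left; apply/eqP; field; rewrite gt_eqF.
Qed.

Let ball_average (nu' : {sigma_finite_measure set X -> \bar R}) (h : X -> \bar R) x :=
  (((m x)^-1)%:E * \int[nu']_(y in ball x) h y)%E.

Let ball_average_ge0 nu' h : (forall x, 0 <= h x)%E ->
  forall x, (0 <= ball_average nu' h x)%E.
Proof. by move=> h0 x; rewrite mule_ge0 ?integral_ge0// lee_fin invr_ge0 ltW. Qed.

Let measurable_ball_average nu' h : (forall x, 0 <= h x)%E -> measurable_fun setT h ->
  measurable_fun setT (ball_average nu' h).
Proof.
move=> h0 mh; apply: emeasurable_funM.
  by apply/measurable_EFinP; exact: measurable_inv_ball_mass.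
apply: (measurable_integral_cball dm dsep dbor nu' r (f := h \o snd)).
  by move=> z; exact: h0.
exact: measurableT_comp mh measurable_snd.
Qed.

Let integral_sum_ball_average_le i (P : pred I) (c : I -> R)
    (nu' : I -> {sigma_finite_measure set X -> \bar R}) (h : I -> X -> \bar R) :
  (forall j, 0 <= c j) -> (forall j x, 0 <= h j x)%E ->
  (forall j, measurable_fun setT (h j)) ->
  (\int[nu i]_(x in S i) \sum_(j | P j) (c j)%:E * ball_average (nu' j) (h j) x <=
   \sum_(j | P j) (c j * (C ^+ 2 * r `^ (- th i)))%:E * \int[nu' j]_y h j y)%E.
Proof.
move=> c0 h0 mh.
have avg_ge0 j x : (0 <= ball_average (nu' j) (h j) x)%E by exact: ball_average_ge0.
have cavg_ge0 j x : (0 <= (c j)%:E * ball_average (nu' j) (h j) x)%E.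
  by rewrite mule_ge0 ?lee_fin.
have mavg j : measurable_fun setT (ball_average (nu' j) (h j)).
  exact: measurable_ball_average.
have mcavg j : measurable_fun setT (fun x => (c j)%:E * ball_average (nu' j) (h j) x)%E.
  exact: emeasurable_funM.
under eq_integral do rewrite -big_filter.
rewrite ge0_integral_sum//; last by move=> j; exact: measurable_funTS.
rewrite big_filter; apply: lee_sum => j _.
apply: (@le_trans _ _ (\int[nu i]_x ((c j)%:E * ball_average (nu' j) (h j) x))%E).
  exact: ge0_le_integral_subset.
rewrite ge0_integralZl ?lee_fin// EFinM -muleA.
apply: lee_wpmul2l; first by rewrite lee_fin.
exact: integral_ball_average_le.
Qed.

Lemma integral_oscE_le_gluing i :
  (\int[nu i]_(x in S i) (wosc x `^ p) <= (#|I|%:R `^ p)%:E *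
     (\int[nu i]_(x in S i) (osc i x `^ p) +
      \sum_(j | j != i) (C ^+ 5 * r `^ th j)%:E * \int[nu i]_y gluing j y))%E.
Proof.
pose c j := C ^+ 3 * r `^ (th i + th j).
have c0 j : 0 <= c j by rewrite mulr_ge0 ?exprn_ge0 ?ltW.
have gluing0 j y : (0 <= gluing j y)%E by exact: gluing_density_ge0.
have mgluing j : measurable_fun setT (gluing j) by exact: measurable_gluing_density.
pose G x := (\sum_(j | j != i) (c j)%:E * ball_average (nu i) (gluing j) x)%E.
have cavg0 j x : (0 <= (c j)%:E * ball_average (nu i) (gluing j) x)%E.
  by rewrite mule_ge0 ?lee_fin// ball_average_ge0.
have G0 x : (0 <= G x)%E by exact: sume_ge0.
have mG : measurable_fun (S i) G.
  rewrite /G; under eq_fun do rewrite -big_filter; apply: emeasurable_sum => j.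
  apply: measurable_funTS; apply: emeasurable_funM => //.
  exact: measurable_ball_average.
have mosc : measurable_fun (S i) (fun x => osc i x `^ p)%E.
  apply: measurable_funTS; apply: (measurableT_comp (measurable_poweR p)).
  exact: measurable_oscE_cball.
have N0 : (0 <= (#|I|%:R `^ p)%:E :> \bar R)%E by rewrite lee_fin powR_ge0.
apply: (@le_trans _ _
    (\int[nu i]_(x in S i) ((#|I|%:R `^ p)%:E * (osc i x `^ p + G x)))%E).
  apply: ge0_le_integral_subset => // x Sx.
  - exact: poweR_ge0.
  - by rewrite mule_ge0// adde_ge0// poweR_ge0.
  exact: oscE_poweR_le_gluing.
rewrite ge0_integralZl//; first last.
- by move=> x _; rewrite adde_ge0// poweR_ge0.
- exact: emeasurable_funD.
apply: lee_wpmul2l => //; rewrite ge0_integralD//; last by move=> x _; exact: poweR_ge0.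
rewrite leeD2l//.
apply: (le_trans (integral_sum_ball_average_le i _ _ c0 gluing0 mgluing)).
apply: lee_sum => j _; rewrite (_ : c j * _ = C ^+ 5 * r `^ th j)// /c.
by rewrite powRD ?(gt_eqF r_gt0) ?implybT// powRN; field; rewrite gt_eqF.
Qed.

Lemma oscE_poweR_le_power i x : S i x ->
  (wosc x `^ p <= (#|I|%:R `^ p)%:E *
     \sum_j (C * r `^ th j)%:E *
       (((m x)^-1)%:E * \int[nu j]_(y in ball x) (`|F y| `^ p)%:E))%E.
Proof.
move=> Sx; have p0 : 0 < p by rewrite (lt_trans ltr01).
have wosc_ge0 : (0 <= wosc x)%E by exact: oscE_weighted_ge0.
have mF_abs : measurable_fun (ball x) (fun y => (`|F y|)%:E).
  by apply: measurable_funTS; apply/measurable_EFinP; exact: measurableT_comp.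
have wosc_le : (wosc x <= AvE (weighted_mass a nu) (weighted_integral a nu) (ball x)
    (fun y => (`|F y|)%:E))%E.
  apply: ereal_inf_lbound; exists 0 => //; congr AvE.
  by apply/funext => y; rewrite subr0.
apply: (le_trans (lee_poweR (ltW p0) wosc_ge0 wosc_le)).
apply: (le_trans (AvE_weighted_poweR_le a_gt0 (mB x) (nu_lty ^~ x) p1 _ mF_abs)) => //.
apply: lee_wpmul2l; first by rewrite lee_fin powR_ge0.
apply: lee_sum => j _; rewrite muleA -EFinM; apply: lee_wpmul2r.
  by apply: integral_ge0 => y _; rewrite lee_fin powR_ge0.
by rewrite lee_fin (weight_share_le _ Sx).
Qed.

Lemma integral_oscE_le_power i :
  (\int[nu i]_(x in S i) (wosc x `^ p) <= (#|I|%:R `^ p)%:E *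
      \sum_j (C ^+ 3 * r `^ (th j - th i))%:E * \int[nu j]_y (`|F y| `^ p)%:E)%E.
Proof.
pose c j := C * r `^ th j; have c0 j : 0 <= c j by rewrite mulr_ge0 ?ltW.
pose h y : \bar R := (`|F y| `^ p)%:E.
have h0 y : (0 <= h y)%E by rewrite lee_fin powR_ge0.
have mh : measurable_fun setT h.
  apply/measurable_EFinP; apply: (measurableT_comp (measurable_powR p)).
  exact: measurableT_comp.
have cavg0 j x : (0 <= (c j)%:E * ball_average (nu j) h x)%E.
  by rewrite mule_ge0 ?lee_fin// ball_average_ge0.
apply: (@le_trans _ _ (\int[nu i]_(x in S i) ((#|I|%:R `^ p)%:E *
    \sum_j (c j)%:E * ball_average (nu j) h x))%E).
  apply: ge0_le_integral_subset => // x Sx.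
  - exact: poweR_ge0.
  - by rewrite mule_ge0 ?lee_fin ?powR_ge0// sume_ge0.
  exact: (oscE_poweR_le_power Sx).
rewrite ge0_integralZl ?lee_fin ?powR_ge0//; first last.
- by move=> x _; apply: sume_ge0 => j _; exact: cavg0.
- apply: measurable_funTS; apply: emeasurable_sum => j.
  by apply: emeasurable_funM => //; exact: measurable_ball_average.
apply: lee_wpmul2l; first by rewrite lee_fin powR_ge0.
apply: (le_trans (integral_sum_ball_average_le i xpredT nu c0 (fun=> h0) (fun=> mh))).
apply: lee_sum => j _; rewrite (_ : c j * _ = C ^+ 3 * r `^ (th j - th i))// /c.
by rewrite powRD ?(gt_eqF r_gt0) ?implybT// powRN; ring.
Qed.

End OneScale.

(** * Summation over the scales *)

Lemma powR_invXn (R : realType) (k : nat) (t : R) :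
  (2 ^- k : R) `^ t = 2 `^ (- (k%:R * t)).
Proof. by rewrite -powR_mulrn// -powRN -powRrM mulNr. Qed.

Lemma nneseries_succ_le (R : realType) (f : nat -> \bar R) :
  (forall k, 0 <= f k)%E ->
  (\sum_(1 <= k <oo) f k.+1 <= \sum_(1 <= k <oo) f k)%E.
Proof.
move=> f0; rewrite -(nneseries_addn 1 f0).
rewrite [leRHS](_ : _ = \sum_(0 <= k <oo) f k.+1)%E; last first.
  by apply: eq_eseriesr => k _; rewrite addn1.
by rewrite [leRHS]nneseries_recl// leeDr.
Qed.

Section AllScales.
Context {R : realType} {d0 : measure_display} {X : measurableType d0} {I : finType}.
Variables (dist : X -> X -> R) (mu : {sigma_finite_measure set X -> \bar R}).
Hypotheses (dm : is_metric dist) (dsep : dseparable dist)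
  (dbor : borel_sets dist).
Hypotheses (mu_lty : forall x r, (mu (cball dist x r) < +oo)%E)
  (mu_gt0 : forall x r, 0 < r -> (0 < mu (cball dist x r))%E).
Variables (p theta : R) (th : I -> R) (S : I -> set X)
  (nu : I -> {sigma_finite_measure set X -> \bar R}).
Hypotheses (p1 : 1 < p) (theta_lt : theta < p) (th0 : forall i, 0 < th i)
  (mS : forall i, measurable (S i)).
Variable C : R.
Hypotheses (C1 : 1 <= C) (dblC : doubling_near dist mu C)
  (regC : forall i, codim_regular dist mu (th i) (S i) (nu i) C).
Variable F : X -> R.
Hypothesis mF : measurable_fun setT F.

Let a (k : nat) i : R := 2 `^ (k%:R * (theta - th i)).

Definition weighted_energy k i : \bar R :=
  (\int[nu i]_(x in S i)
     (oscE (weighted_mass (a k) nu) (weighted_integral (a k) nu) F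
        (cball dist x (2 ^- k)) `^ p))%E.

(* When [nu i] is [H i] restricted to [S i], this is the k-th summand in the third
   term of [BN], with [S] for its porous part; [oscillation_energy] and
   [gluing_energy] are the summands in the Besov seminorms and in [GL1]. *)
Definition level_energy k : \bar R :=
  ((2 `^ (k%:R * (theta - p)))%:E * \sum_i (a k i)%:E * weighted_energy k i)%E.

Definition power_energy i : \bar R := (\int[nu i]_y (`|F y| `^ p)%:E)%E.

Definition oscillation_energy i k : \bar R :=
  ((2 `^ (k%:R * (p - th i)))%:E * \int[nu i]_(x in S i)
     (oscE (nu i) (mu_int (nu i)) F (cball dist x (2 ^- k)) `^ p))%E.

Definition gluing_energy i j k : \bar R :=
  ((2 `^ (k%:R * (p - th i - th j)))%:E *
   \int[nu i]_y gluing_density dist mu F p (nu j) (2 ^- k) y)%E.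

Definition scale_constant : R := #|I|%:R `^ p * 2 `^ p * C ^+ 5.

Local Notation D := scale_constant.

Let C0 : 0 <= C. Proof. exact: le_trans ler01 C1. Qed.

Let two_gt0 : 0 < 2 :> R. Proof. exact: ltr0n. Qed.

Let a_ge0 k i : 0 <= a k i. Proof. exact: powR_ge0. Qed.

Let aE k j : a k j = 2 `^ (k%:R * theta) * (2 ^- k) `^ th j.
Proof. by rewrite powR_invXn -powRD ?pnatr_eq0 ?implybT// /a mulrBr. Qed.

Let dyadic_radius k : 0 < (2 ^- k.+1 : R) <= 2^-1.
Proof.
rewrite invr_gt0 exprn_gt0//= lef_pV2 ?posrE ?exprn_gt0//.
by rewrite -[leLHS]expr1 ler_weXn2l// ler1n.
Qed.

Let level_weight_le k i : 2 `^ (k%:R * (theta - p)) * a k i <= 2 `^ (k%:R * (p - th i)).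
Proof.
rewrite /a -powRD ?pnatr_eq0 ?implybT// -mulrDr.
by apply: ler_powR; [rewrite ler1n|apply: ler_wpM2l => //; have := theta_lt; lra].
Qed.

Let scale_constantE : D = #|I|%:R `^ p * (2 `^ p * C ^+ 5).
Proof. by rewrite /scale_constant mulrA. Qed.

Lemma scale_constant_ge0 : 0 <= D.
Proof. by rewrite !mulr_ge0 ?powR_ge0 ?exprn_ge0. Qed.

Let weighted_energy_ge0 k i : (0 <= weighted_energy k i)%E.
Proof. by apply: integral_ge0 => x _; exact: poweR_ge0. Qed.

Lemma power_energy_ge0 i : (0 <= power_energy i)%E.
Proof. by apply: integral_ge0 => y _; rewrite lee_fin powR_ge0. Qed.

Lemma oscillation_energy_ge0 i k : (0 <= oscillation_energy i k)%E.
Proof.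
by rewrite mule_ge0 ?lee_fin//; apply: integral_ge0 => x _; exact: poweR_ge0.
Qed.

Lemma gluing_energy_ge0 i j k : (0 <= gluing_energy i j k)%E.
Proof.
by rewrite mule_ge0 ?lee_fin//; apply: integral_ge0 => x _; exact: gluing_density_ge0.
Qed.

Lemma level_energy_ge0 k : (0 <= level_energy k)%E.
Proof.
rewrite mule_ge0 ?lee_fin//; apply: sume_ge0 => i _.
by rewrite mule_ge0 ?lee_fin.
Qed.

Lemma level_energy_le k (V : I -> \bar R) :
  (forall i, weighted_energy k i <= V i)%E ->
  (level_energy k <= \sum_i (2 `^ (k%:R * (p - th i)))%:E * V i)%E.
Proof.
move=> EV; rewrite /level_energy ge0_sume_distrr => [|i _]; last first.
  by rewrite mule_ge0 ?lee_fin.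
apply: lee_sum => i _; rewrite muleA -EFinM.
by apply: lee_pmul; rewrite ?lee_fin// mulr_ge0.
Qed.

Lemma level_energy1_le : (level_energy 1 <= (D * #|I|%:R)%:E * \sum_j power_energy j)%E.
Proof.
have weighted_le i := integral_oscE_le_power dm dsep dbor mu_lty mu_gt0 mS C1 dblC regC
  (dyadic_radius 0) (powR_gt0 _ two_gt0) (aE 1) mF p1 i.
apply: (le_trans (level_energy_le weighted_le)).
have coef_le i j : 2 `^ (1%:R * (p - th i)) * (C ^+ 3 * (2 ^- 1) `^ (th j - th i)) <=
    2 `^ p * C ^+ 5.
  rewrite mulrCA mulrC; apply: ler_pM; rewrite ?mulr_ge0 ?exprn_ge0//.
    rewrite powR_invXn -powRD ?pnatr_eq0 ?implybT//.
    apply: ler_powR; first by rewrite ler1n.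
    by have := th0 j; lra.
  by rewrite ler_weXn2l.
apply: (@le_trans _ _ (\sum_(i in I) (D%:E * \sum_j power_energy j))%E); last first.
  by rewrite sumr_const (mulrC D) (EFinM #|I|%:R) -muleA mule_natl.
apply: lee_sum => i _; rewrite muleCA scale_constantE EFinM -muleA.
apply: lee_wpmul2l; first by rewrite lee_fin.
rewrite !ge0_sume_distrr => [|j _|j _]; first last.
- by rewrite mule_ge0 ?power_energy_ge0// lee_fin mulr_ge0 ?exprn_ge0.
- exact: power_energy_ge0.
apply: lee_sum => j _; rewrite muleA -EFinM.
by apply: lee_wpmul2r; [exact: power_energy_ge0|rewrite lee_fin].
Qed.

Let scale_factor_ge1 : 1 <= 2 `^ p * C ^+ 5.
Proof.
rewrite -[leLHS]mul1r ler_pM ?exprn_ege1// -[leLHS](powRr0 2).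
by apply: ler_powR; rewrite ?ler1n// ltW// (lt_trans ltr01).
Qed.

Let gluing_factor_le i j k :
  2 `^ (k.+1%:R * (p - th i)) * (C ^+ 5 * (2 ^- k.+1) `^ th j) <=
  2 `^ p * C ^+ 5 * 2 `^ (k%:R * (p - th i - th j)).
Proof.
have C5_gt0 : 0 < C ^+ 5 by rewrite exprn_gt0// (lt_le_trans ltr01).
rewrite [leLHS]mulrCA [leRHS]mulrAC [leRHS]mulrC ler_pM2l// powR_invXn.
rewrite -!powRD ?pnatr_eq0 ?implybT//; apply: ler_powR; first by rewrite ler1n.
by rewrite -natr1; have := th0 i; have := th0 j; lra.
Qed.

Lemma level_energy_succ_le k :
  (level_energy k.+1 <= D%:E * \sum_i (oscillation_energy i k.+1 +
     \sum_(j | j != i) gluing_energy i j k))%E.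
Proof.
have weighted_le i := integral_oscE_le_gluing dm dsep dbor mu_lty mu_gt0 mS C1 dblC regC
  (dyadic_radius k) (powR_gt0 _ two_gt0) (aE k.+1) mF p1 i.
apply: (le_trans (level_energy_le weighted_le)).
have N0 : 0 <= #|I|%:R `^ p :> R by exact: powR_ge0.
have radius2 : 2 * 2 ^- k.+1 = 2 ^- k :> R by rewrite exprS invfM mulrA divff ?mul1r.
rewrite ge0_sume_distrr => [|i _]; last first.
  rewrite adde_ge0 ?oscillation_energy_ge0// sume_ge0// => j _.
  exact: gluing_energy_ge0.
apply: lee_sum => i _; rewrite muleCA scale_constantE EFinM -muleA.
apply: lee_wpmul2l; first by rewrite lee_fin.
have osc0 := oscillation_energy_ge0 i k.+1.
have gluing0 j := gluing_energy_ge0 i j k.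
pose gl j := (\int[nu i]_y gluing_density dist mu F p (nu j) (2 ^- k) y)%E.
have gl0 j : (0 <= gl j)%E by apply: integral_ge0 => y _; exact: gluing_density_ge0.
have term0 j : (0 <= (C ^+ 5 * (2 ^- k.+1) `^ th j)%:E * gl j)%E.
  by apply: mule_ge0 (gl0 j); rewrite lee_fin mulr_ge0 ?powR_ge0 ?exprn_ge0.
rewrite radius2 ge0_muleDr; first last.
- by apply: sume_ge0 => j _; exact: term0.
- by apply: integral_ge0 => x _; exact: poweR_ge0.
rewrite [leRHS]ge0_muleDr//; last exact: sume_ge0.
apply: leeD; first by rewrite lee_pemull// lee_fin; exact: scale_factor_ge1.
rewrite !ge0_sume_distrr//.
apply: lee_sum => j _; rewrite /gluing_energy -/(gl j) !muleA -!EFinM.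
by apply: lee_wpmul2r; rewrite ?lee_fin ?gluing_factor_le.
Qed.

Lemma sum_level_energy_le :
  (\sum_(1 <= k <oo) level_energy k <= (D * (#|I|%:R + 1))%:E *
     (\sum_i power_energy i +
      \sum_i \sum_(1 <= k <oo) oscillation_energy i k +
      \sum_i \sum_(j | j != i) \sum_(1 <= k <oo) gluing_energy i j k))%E.
Proof.
have D0 := scale_constant_ge0; have T0 := level_energy_ge0.
have Q0 := oscillation_energy_ge0.
have G0 := gluing_energy_ge0; have L0 := power_energy_ge0.
set L := (\sum_i power_energy i)%E; set Q := (\sum_i \sum_(1 <= k <oo) _)%E.
set G := (\sum_i \sum_(j | _) _)%E.
have L_ge0 : (0 <= L)%E by apply: sume_ge0 => i _.
have Q_ge0 : (0 <= Q)%E by apply: sume_ge0 => i _; exact: nneseries_ge0.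
have G_ge0 : (0 <= G)%E.
  by apply: sume_ge0 => i _; apply: sume_ge0 => j _; exact: nneseries_ge0.
have QG0 i k : (0 <= oscillation_energy i k.+1 + \sum_(j | j != i) gluing_energy i j k)%E.
  by rewrite adde_ge0// sume_ge0.
have sum_succ : (\sum_(1 <= k <oo) level_energy k.+1 <= D%:E * (Q + G))%E.
  apply: (@le_trans _ _ (\sum_(1 <= k <oo) (D%:E * \sum_i (oscillation_energy i k.+1 +
      \sum_(j | j != i) gluing_energy i j k)))%E).
    by apply: lee_nneseries => // k _; exact: level_energy_succ_le.
  rewrite nneseriesZl => [|k _]; last exact: sume_ge0.
  apply: lee_wpmul2l; rewrite ?lee_fin// nneseries_sum// -big_split.
  apply: lee_sum => i _; rewrite nneseriesD//; last by move=> k _ _; exact: sume_ge0.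
  by apply: leeD; [exact: nneseries_succ_le|rewrite nneseries_sum].
rewrite -nneseries_addn// nneseries_recl// add0n.
under eq_eseriesr do rewrite addn1.
apply: (le_trans (leeD level_energy1_le sum_succ)).
rewrite mulrDr mulr1 EFinD ge0_muleDl ?lee_fin ?mulr_ge0//.
rewrite -addeA; apply: leeD; apply: lee_wpmul2l; rewrite ?lee_fin ?mulr_ge0//.
- by rewrite leeDl// adde_ge0.
- by rewrite leeDr.
Qed.

End AllScales.

(** * Comparison of the trace functionals *)

Definition sigma_finite_bundle (d : measure_display) (T : measurableType d)
    (R : realType) (nu : {measure set T -> \bar R}) (sf : sigma_finite setT nu) :
    {sigma_finite_measure set T -> \bar R} :=
  HB.pack_for (SigmaFiniteMeasure.type T R) (Measure.sort nu)
    (isSFinite.Build _ _ _ _ (sfinite_measure_sigma_finite sf))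
    (isSigmaFinite.Build _ _ _ _ sf).

Section RestrictedFamily.
Context {R : realType} {d0 : measure_display} {X : measurableType d0}.
Variables (dist : X -> X -> R) (mu : {measure set X -> \bar R}).
Hypotheses (dm : is_metric dist) (dsep : dseparable dist)
  (dbor : borel_sets dist).
Hypotheses (mu_lty : forall x r, (mu (cball dist x r) < +oo)%E)
  (mu_gt0 : full_support dist mu).
Variables (N : nat) (p theta : R) (th : 'I_N -> R) (S : 'I_N -> set X)
  (H : 'I_N -> {measure set X -> \bar R}).
Hypotheses (p1 : 1 < p) (theta_lt : theta < p) (th0 : forall i, 0 < th i)
  (mS : forall i, measurable (S i))
  (HE : forall i A, measurable A -> H i A = Hcont dist mu (th i) A).
Variable C : R.
Hypotheses (C1 : 1 <= C) (dblC : doubling_near dist mu C)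
  (regC : forall i, codim_regular dist mu (th i) (S i) (mrestr (H i) (mS i)) C).

Let half_radius : 0 < (2^-1 : R) <= 2^-1.
Proof. by rewrite invr_gt0 ltr0n lexx. Qed.

Let half_gt0 : 0 < (2^-1 : R). Proof. by case/andP: half_radius. Qed.

Let mrestr_half_ball_lty i x : (mrestr (H i) (mS i) (cball dist x 2^-1) < +oo)%E.
Proof.
apply: (le_lt_trans ((regC i).2 x 2^-1 half_radius)).
by rewrite -(fineK (x := mu _)) ?ge0_fin_numE// -EFinM ltry.
Qed.

Let sigma_finite_mrestr i : sigma_finite setT (mrestr (H i) (mS i)).
Proof. exact: (sigma_finite_cball dm dsep dbor half_gt0 (mrestr_half_ball_lty i)). Qed.

Let sigma_finite_mu : sigma_finite setT mu.
Proof. exact: (sigma_finite_cball dm dsep dbor half_gt0 (fun x => mu_lty x _)). Qed.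

Let nu i := sigma_finite_bundle (sigma_finite_mrestr i).

Let mu' := sigma_finite_bundle sigma_finite_mu.

Lemma measurable_Sall : measurable (Sall S).
Proof. by apply: fin_bigcup_measurable => // i _; exact: mS. Qed.

Lemma Sall_null : mu (Sall S) = 0%E.
Proof.
have mu_S i : mu (S i) = 0%E.
  apply: (null_set_cball dm dsep dbor half_gt0 (mS i)) => x.
  have mBS : measurable (cball dist x 2^-1 `&` S i).
    by apply: measurableI => //; exact: measurable_cball.
  apply: (Hcont_lty_null dm dbor (th0 i) mBS).
  by rewrite -HE//; exact: mrestr_half_ball_lty.
apply: (measure_negligible measurable_Sall).
rewrite /Sall (_ : \bigcup_(_ in _) _ = \big[setU/set0]_(i in 'I_N) S i).
  elim/big_ind : _ => [|A B|i _]; [exact: negligible_set0|exact: negligibleU|].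
  by apply/negligibleP; [exact: mS|exact: mu_S].
by rewrite -bigcup_pred; congr bigcup; apply/seteqP; split.
Qed.

Section TraceFunctionals.
Variable f : X -> R.
Hypothesis f_Lp : in_Lp_all p S H f.

Let F : X -> R := f \_ (Sall S).

Let FE i x : S i x -> F x = f x.
Proof. by move=> Sx; rewrite /F patchE mem_set//; exists i. Qed.

Let mF : measurable_fun setT F.
Proof.
apply/(measurable_restrictT _ measurable_Sall) => _ Y mY; rewrite setI_bigcupl.
by apply: fin_bigcup_measurable => // i _; exact: (f_Lp i).1.
Qed.

Let integral_nu i (D : set X) (g g' : X -> \bar R) : measurable D ->
  measurable_fun D g -> (forall x, D x -> 0 <= g x)%E ->
  (forall x, D x -> S i x -> g x = g' x) ->
  (\int[nu i]_(x in D) g x = \int[H i]_(x in D `&` S i) g' x)%E.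
Proof.
move=> mD mg g0 gg'; rewrite (ge0_integral_mrestr (H i) (mS i) mD mg g0).
by apply: eq_integral => x /set_mem[Dx Sx]; exact: gg'.
Qed.

Let integral_nu_dist i c (B : set X) : measurable B ->
  (\int[nu i]_(x in B) (`|F x - c|)%:E = \int[H i]_(x in B `&` S i) (`|f x - c|)%:E)%E.
Proof.
move=> mB; apply: integral_nu => // [|x _ Sx]; last by rewrite (FE Sx).
apply/measurable_EFinP/measurableT_comp => //; apply: measurable_funB => //.
exact: measurable_funTS.
Qed.

Let oscE_mk k (B : set X) : measurable B ->
  oscE (mk_mass theta th S H k) (mk_int theta th S H k) f B =
  oscE (weighted_mass (coef theta th k) nu) (weighted_integral (coef theta th k) nu) F B.
Proof.
move=> mB; apply: eq_oscE => // c.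
by apply: eq_bigr => i _; rewrite -integral_nu_dist.
Qed.

Let oscE_trace i (B : set X) : measurable B ->
  oscE (fun G => H i (G `&` S i)) (fun G g => \int[H i]_(y in G `&` S i) g y)%E f B =
  oscE (nu i) (mu_int (nu i)) F B.
Proof. by move=> mB; apply: eq_oscE => // c; rewrite -integral_nu_dist. Qed.

Let power_energyE i :
  power_energy p nu F i = (\int[H i]_(x in S i) (`|f x| `^ p)%:E)%E.
Proof.
rewrite -[in RHS](setTI (S i)).
apply: integral_nu => // [|x _ Sx]; last by rewrite (FE Sx).
apply/measurable_EFinP; apply: (measurableT_comp (measurable_powR p)).
exact: measurableT_comp.
Qed.

Let gluing_density_trace i j k y : S i y ->
  gluing_density dist mu' F p (nu j) (2 ^- k) y =
  (\int[H j]_(z in S j)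
     (if (dist y z <= 2 ^- k)%R then (wk dist mu k y z * `|f y - f z| `^ p)%:E else 0))%E.
Proof.
move=> Sy; transitivity (\int[H j]_(z in cball dist y (2 ^- k) `&` S j)
    (wk dist mu k y z * `|f y - f z| `^ p)%:E)%E.
  apply: integral_nu.
  - exact: measurable_cball.
  - apply: measurable_funTS.
    exact: (measurableT_comp (measurable_gluing_kernel mu' dm dsep dbor p mF (2 ^- k))
      (pair1_measurable y)).
  - by move=> z _; rewrite lee_fin mulr_ge0 ?powR_ge0.
  - by move=> z _ Sz; rewrite (FE Sy) (FE Sz).
rewrite setIC integral_mkcondr; apply: eq_integral => z _; rewrite patchE.
by case: ifPn => [/set_mem ->|/negP nz] //; case: ifP => // yz; case: nz; exact: mem_set.
Qed.

Let gluing_energyE i j k : gluing_energy dist mu' p th nu F i j k =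
  ((2 `^ (k%:R * (p - th i - th j)))%:E *
   \int[H i]_(y in S i) \int[H j]_(z in S j)
     (if (dist y z <= 2 ^- k)%R then (wk dist mu k y z * `|f y - f z| `^ p)%:E else 0))%E.
Proof.
congr (_ * _)%E; rewrite -[in RHS](setTI (S i)).
apply: integral_nu => // [|y _|y _ Sy].
- exact: measurable_gluing_density.
- exact: gluing_density_ge0.
- exact: (gluing_density_trace _ _ Sy).
Qed.

Let oscillation_energyE i k : oscillation_energy dist p th S nu F i k =
  ((2 `^ (k%:R * (1 - th i / p) * p))%:E *
   \int[H i]_(x in S i)
     (oscE (fun G => H i (G `&` S i)) (fun G g => \int[H i]_(y in G `&` S i) g y)
       f (cball dist x (2 ^- k)) `^ p))%E.
Proof.
have p0 : 0 < p by rewrite (lt_trans ltr01).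
have -> : k%:R * (1 - th i / p) * p = k%:R * (p - th i) by field; rewrite gt_eqF.
rewrite (eq_integral (fun x =>
    oscE (nu i) (mu_int (nu i)) F (cball dist x (2 ^- k)) `^ p)%E) => [|x _].
  by rewrite -(integral_mrestr_subset (H i) (mS i) _ (subset_refl (A := S i))).
by rewrite oscE_trace//; exact: measurable_cball.
Qed.

Local Notation besov i := (Besov dist p S H i (1 - th i / p) f).
Local Notation trace_norm := (\sum_(i < N) besov i + GL1 dist mu p th S H f)%E.

Let p0 : 0 < p. Proof. exact: lt_trans ltr01 p1. Qed.

Let besov_ge0 i : (0 <= besov i)%E.
Proof. by rewrite adde_ge0// poweR_ge0. Qed.

Let GL1_ge0 : (0 <= GL1 dist mu p th S H f)%E. Proof. exact: poweR_ge0. Qed.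

Let besov_le i : (besov i <= trace_norm)%E.
Proof. by rewrite (bigD1 i)//= -addeA leeDl// adde_ge0// sume_ge0. Qed.

Let GL1_le : (GL1 dist mu p th S H f <= trace_norm)%E.
Proof. by rewrite leeDr// sume_ge0. Qed.

Let power_energy_le i : (power_energy p nu F i <= trace_norm `^ p)%E.
Proof.
apply: (le_poweRV p0 (power_energy_ge0 _ _ _ _)); apply: le_trans (besov_le i).
by rewrite power_energyE leeDl// poweR_ge0.
Qed.

Let sum_oscillation_energy_le i :
  (\sum_(1 <= k <oo) oscillation_energy dist p th S nu F i k <= trace_norm `^ p)%E.
Proof.
apply: le_poweRV => //.
  by apply: nneseries_ge0 => k _ _; exact: oscillation_energy_ge0.
apply: le_trans (besov_le i).
under eq_eseriesr do rewrite oscillation_energyE.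
by rewrite leeDr// poweR_ge0.
Qed.

Let sum_gluing_energy_le :
  (\sum_(i < N) \sum_(j < N | j != i)
     \sum_(1 <= k <oo) gluing_energy dist mu' p th nu F i j k <= trace_norm `^ p)%E.
Proof.
have gluing0 := gluing_energy_ge0 dist mu' p th nu F.
apply: le_poweRV => //.
  by apply: sume_ge0 => i _; apply: sume_ge0 => j _; exact: nneseries_ge0.
apply: le_trans GL1_le; rewrite /GL1 le_eqVlt; apply/orP; left; apply/eqP.
congr (_ `^ _)%E; apply: eq_bigr => i _; apply: eq_big => [j|j _].
  by rewrite eq_sym.
by apply: eq_eseriesr => k _; exact: gluing_energyE.
Qed.

Let mk_int_ge0 k (G : set X) g : (forall x, 0 <= g x)%E ->
  (0 <= mk_int theta th S H k G g)%E.
Proof.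
move=> g0; apply: sume_ge0 => i _.
by rewrite mule_ge0 ?lee_fin ?powR_ge0//; exact: integral_ge0.
Qed.

Let mk_energy sigma k : \bar R :=
  ((2 `^ (k%:R * (theta - p)))%:E *
   mk_int theta th S H k (porous_part dist (Sall S) sigma (2 ^- k))
     (fun x => oscE (mk_mass theta th S H k) (mk_int theta th S H k) f
        (cball dist x (2 ^- k)) `^ p))%E.

Let mk_energy_ge0 sigma k : (0 <= mk_energy sigma k)%E.
Proof.
rewrite mule_ge0 ?lee_fin ?powR_ge0//; apply: mk_int_ge0 => x; exact: poweR_ge0.
Qed.

Let mk_energy_le sigma k :
  (mk_energy sigma k <= level_energy dist p theta th S nu F k)%E.
Proof.
apply: lee_wpmul2l; first by rewrite lee_fin powR_ge0.
apply: lee_sum => i _; apply: lee_wpmul2l; first by rewrite lee_fin powR_ge0.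
rewrite /weighted_energy (integral_mrestr_subset (H i) (mS i) _ (subset_refl (A := S i))).
apply: ge0_le_integral_subset => [x _|x _|x []//|x _]; try exact: poweR_ge0.
by rewrite oscE_mk//; exact: measurable_cball.
Qed.

Definition comparison_constant : R :=
  N%:R `^ p^-1 +
  (scale_constant (I := 'I_N) p C * (N%:R + 1) * (N%:R + N%:R + 1)) `^ p^-1.

Lemma BN_le sigma :
  (BN dist mu p theta th S H sigma f <= comparison_constant%:E * trace_norm)%E.
Proof.
have T0 : (0 <= trace_norm)%E by rewrite adde_ge0// sume_ge0.
have Tp0 : (0 <= trace_norm `^ p)%E by exact: poweR_ge0.
set D := scale_constant (I := 'I_N) p C.
have D0 : 0 <= D by exact: scale_constant_ge0.
have sum_const (V : 'I_N -> \bar R) : (forall i, V i <= trace_norm `^ p)%E ->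
    (\sum_(i < N) V i <= N%:R%:E * trace_norm `^ p)%E.
  move=> VT; apply: (@le_trans _ _ (\sum_(i < N) trace_norm `^ p)%E).
    exact: lee_sum.
  by rewrite sumr_const card_ord mule_natl.
have Lp_term : (mk_int theta th S H 0 [set: X] (fun x => (`|f x| `^ p)%:E) <=
    N%:R%:E * trace_norm `^ p)%E.
  apply: sum_const => i; rewrite /coef mul0r powRr0 mul1e setTI -power_energyE.
  exact: power_energy_le.
have sharp_term : (\int[mu]_(x in Sall S) (fsharp dist theta th S H f x `^ p) = 0)%E.
  exact: integral_null_set measurable_Sall Sall_null.
have energy_term : (\sum_(1 <= k <oo) mk_energy sigma k <=
    (D * (N%:R + 1) * (N%:R + N%:R + 1))%:E * trace_norm `^ p)%E.
  apply: (@le_trans _ _ (\sum_(1 <= k <oo) level_energy dist p theta th S nu F k)%E).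
    by apply: lee_nneseries => // k _; exact: mk_energy_le.
  have := sum_level_energy_le dm dsep dbor (mu := mu') mu_lty mu_gt0 p1 theta_lt th0 mS C1
    dblC (nu := nu) regC mF.
  rewrite card_ord -/D => /le_trans; apply; rewrite [in leRHS]EFinM -muleA.
  apply: lee_wpmul2l; first by rewrite lee_fin mulr_ge0.
  rewrite !EFinD !ge0_muleDl ?lee_fin// mul1e.
  apply: leeD; last exact: sum_gluing_energy_le.
  by apply: leeD; apply: sum_const.
rewrite /BN sharp_term poweR0r ?invr_eq0 ?gt_eqF// adde0.
rewrite /comparison_constant EFinD ge0_muleDl ?lee_fin ?powR_ge0//.
apply: leeD; apply: poweRV_le => //.
- by apply: mk_int_ge0 => x; rewrite lee_fin powR_ge0.
- by rewrite mulr_ge0 ?addr_ge0// mulr_ge0.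
- by apply: nneseries_ge0 => k _ _; exact: mk_energy_ge0.
Qed.

End TraceFunctionals.
End RestrictedFamily.

Theorem theorem3p12 (R : realType) (d0 : measure_display) (X : measurableType d0)
  (dist : X -> X -> R) (mu : {measure set X -> \bar R}) (p : R)
  (thlow theta : R) (N : nat) (th : 'I_N -> R) (S : 'I_N -> set X)
  (H : 'I_N -> {measure set X -> \bar R}) (sig : 'I_N -> R) :
  is_metric dist -> dcomplete dist -> dseparable dist -> borel_sets dist ->
  locally_finite dist mu -> full_support dist mu -> unif_loc_doubling dist mu ->
  1 < p -> poincare dist mu p ->
  0 <= thlow -> thlow < p -> (thlow%:E < Q_lower dist mu)%E ->
  thlow <= theta -> theta < p ->
  (2 <= N)%N ->
  (forall i, 0 < th i) ->
  (forall i j : 'I_N, (i < j)%N -> th i < th j) ->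
  (forall i : 'I_N, val i = N.-1 -> th i = thlow) ->
  (forall i, ADR dist mu (th i) (S i)) ->
  (forall i A, measurable A -> H i A = Hcont dist mu (th i) A) ->
  (forall i, 0 < sig i < 1 /\ porous dist (S i) (sig i)) ->
  forall sigma : R, 0 < sigma <= \prod_(i < N) (2 * sig i / 3) ->
  exists C : R, 0 < C /\
    forall f : X -> R, in_Lp_all p S H f ->
      (BN dist mu p theta th S H sigma f <=
        C%:E * (\sum_(i < N) Besov dist p S H i (1 - th i / p) f
                 + GL1 dist mu p th S H f))%E.
Proof.
move=> dm _ dsep dbor lf supp dbl p1 _ _ _ _ _ theta_lt N2 th0 _ _ SADR HE _ sigma _.
have mS i : measurable (S i).
  by have [clS _] := SADR i; exact: (measurable_dclosed dbor).
have [C [C1 dblC regC]] := exists_regularity_constant mS dm dbor dbl th0 SADR HE.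
have mu_lty := cball_lty dm dbor lf dbl.
exists (comparison_constant N p C); split.
  by rewrite /comparison_constant ltr_pwDl ?powR_ge0// powR_gt0// ltr0n ltnW.
move=> f f_Lp.
exact: (BN_le dm dsep dbor mu_lty supp p1 theta_lt th0 HE C1 dblC regC f_Lp).
Qed.
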